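(* For all $t>0$ and $\varepsilon>0$, $$\mathbf{Diff}_{2t}\supset\mathbf{Diff}_{[t]}\supset\mathbf{Diff}_{2t+\varepsilon}.$$ Also, $$\bigcap_{t>0}\mathbf{Diff}_{[t]}=\bigcap_{t>0}\mathbf{Diff}_t .$$
   Context: $\overline{\mathbf{Diff}}$ is the group (under substitution) of formal power series $\gamma(x)=x+\sum_{j\ge 2}a_jx^j$, $a_j\in\mathbb{R}$. For $s>0$, $\mathbf{Diff}_s\subset\overline{\mathbf{Diff}}$ is the set of $\gamma$ with $\sum_{j\ge2}\frac{|a_j|s^{j-1}}{j!}<\infty$. $\mathfrak{vect}$ is the real Lie algebra with basis $L_1,L_2,\dots$ and $[L_n,L_m]=(m-n)L_{m+n}$, realized on $\overline V=\mathbb{R}[[x]]$ by $L_n=x^{n+1}\frac{d}{dx}$; $\overline{\mathbf{vect}}$ is the Lie algebra of formal series $\sum_{j\ge1}p_jL_j$. $U(\mathfrak{vect})=\bigoplus_{n\ge0}U^{(n)}(\mathfrak{vect})$ is the universal enveloping algebra graded by $\deg L_n=n$, and $\overline{\mathbf{U}}(\mathfrak{vect})$ is the algebra of formal series $\sum_{n\ge0}u^{(n)}$ with $u^{(n)}\in U^{(n)}(\mathfrak{vect})$. Let $\mathcal{A}_2$ be the free unital associative real algebra on $\omega_1,\omega_2$, with norm $R_{[1,1]}(\sum_Ic_I\omega^I)=\sum_I|c_I|$ (sum over noncommutative monomials), and let $\pi:\mathcal{A}_2\to U(\mathfrak{vect})$ be the (surjective) unital homomorphism with $\omega_1\mapsto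 L_1$, $\omega_2\mapsto L_2$. Set $Q_{[1]}(u)=\min_{w\in\mathcal{A}_2:\,\pi(w)=u}R_{[1,1]}(w)$ for $u\in U(\mathfrak{vect})$. For $t>0$ let $\mathbf{U}_{[t]}(\mathfrak{vect})$ be the set of $\sum u^{(n)}\in\overline{\mathbf{U}}(\mathfrak{vect})$ with $\sum_n t^nQ_{[1]}(u^{(n)})<\infty$. Each $\gamma\in\overline{\mathbf{Diff}}$ corresponds bijectively (a known fact) to $\mathcal{L}\in\overline{\mathbf{vect}}$ by: $F(x)\mapsto F(\gamma(x))$ equals the operator $\sum_{k\ge0}\mathcal{L}^k/k!$ on $\overline V$. In this way $\overline{\mathbf{Diff}}$ is identified with $\exp(\overline{\mathbf{vect}})=\{\sum_k\mathcal{L}^k/k!:\mathcal{L}\in\overline{\mathbf{vect}}\}\subset\overline{\mathbf{U}}(\mathfrak{vect})$, and $\mathbf{Diff}_{[t]}:=\exp(\overline{\mathbf{vect}})\cap\mathbf{U}_{[t]}(\mathfrak{vect})$ is viewed as a subset of $\overline{\mathbf{Diff}}$. *)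

(* Defs.v *)
From HB Require Import structures.
From mathcomp Require Import all_boot all_order all_algebra generic_quotient.
From mathcomp Require Import finmap.
From mathcomp Require Import boolp classical_sets reals ereal normedtype.
From mathcomp Require Import sequences.
(* The notations of monalg clash with those of mathcomp-analysis. *)
From mathcomp Require Import -(notations) monalg.

Set Implicit Arguments.
Unset Strict Implicit.
Unset Printing Implicit Defensive.

Import Order.TTheory GRing.Theory Num.Theory.

Local Open Scope ring_scope.
Local Open Scope classical_set_scope.
Local Open Scope quotient_scope.

(* The free unital associative R-algebra on the letters in I: the monoid      *)
(* algebra over R of the free monoid {fmonom I} of words in I.                *)
Definition free_alg (R : realType) (I : choiceType) : Type :=
  malg (fmonom I) R.

HB.instance Definition _ (R : realType) (I : choiceType) :=
  GRing.Lalgebra.copy (free_alg R I) (malg (fmonom I) R).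

Definition letter (R : realType) (I : choiceType) (i : I) : free_alg R I :=
  mkmalgU (fmu i) 1.

Lemma free_alg_scalerAr (R : realType) (I : choiceType) (c : R)
  (x y : malg (fmonom I) R) : c *: (x * y) = x * (c *: y).
Proof.
have comC (z : malg (fmonom I) R) : z * mkmalgU mone c = c *: z.
  rewrite -mul_malgC [LHS]fgmulgU [RHS]fgmulUg; apply: eq_bigr => k _.
  by rewrite mulm1 mul1m mulrC.
by rewrite -(mul_malgC c y) mulrA comC scalerAl.
Qed.

HB.instance Definition _ (R : realType) (I : choiceType) :=
  GRing.Lalgebra_isAlgebra.Build R (free_alg R I) (@free_alg_scalerAr R I).

Section FreeEval.
Variables (R : realType) (I : choiceType) (A : algType R) (X : I -> A).

Definition word_eval (m : fmonom I) : A := \prod_(i <- fmonom_val m) X i.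

Definition free_eval (w : free_alg R I) : A :=
  \sum_(m <- msupp w) mcoeff m w *: word_eval m.

Lemma word_eval_mmorphism : mmorphism word_eval.
Proof.
split=> [m1 m2|]; rewrite /word_eval; first by rewrite fmM big_cat.
by rewrite fm1 big_nil.
Qed.

HB.instance Definition _ :=
  isMultiplicative.Build (fmonom I) A word_eval word_eval_mmorphism.

Lemma free_evalE : free_eval =1 mmap (in_alg A) word_eval.
Proof. by move=> w; apply: eq_bigr => m _; rewrite mulr_algl. Qed.

Lemma free_eval_zmod_morphism : zmod_morphism free_eval.
Proof. by move=> x y; rewrite !free_evalE raddfB. Qed.

Lemma free_eval_monoid_morphism : monoid_morphism free_eval.
Proof.
have cfX (g : free_alg R I) (m m' : fmonom I) :
  GRing.comm (in_alg A (mcoeff m g)) (word_eval m').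
  by rewrite /GRing.comm /= mulr_algl mulr_algr.
have [mM m1] := commr_mmap_is_multiplicative cfX.
by split=> [|x y]; rewrite !free_evalE ?m1 // mM.
Qed.

HB.instance Definition _ := GRing.isZmodMorphism.Build (free_alg R I) A
  free_eval free_eval_zmod_morphism.
HB.instance Definition _ := GRing.isMonoidMorphism.Build (free_alg R I) A
  free_eval free_eval_monoid_morphism.

Lemma free_eval_letter i : free_eval (letter R i) = X i.
Proof.
rewrite free_evalE mmapU /= mulr_algl scale1r /word_eval /fmu fmE.
by rewrite big_seq1.
Qed.

End FreeEval.

(* U(vect): the free algebra on L_1, L_2, ... modulo the two-sided ideal      *)
(* generated by L_n L_m - L_m L_n - [L_n, L_m]. The letter i stands for       *)
(* L_(i+1), so that freeL n is meant for n >= 1 only.                         *)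
Section Enveloping.
Variable R : realType.

Local Notation T := (free_alg R nat).

Definition freeL (n : nat) : T := letter R n.-1.

Inductive vect_ideal : T -> Prop :=
| vect_ideal_rel n m : (0 < n)%N -> (0 < m)%N ->
    vect_ideal (freeL n * freeL m - freeL m * freeL n
                - (m%:R - n%:R) *: freeL (m + n))
| vect_ideal0 : vect_ideal 0
| vect_idealD x y : vect_ideal x -> vect_ideal y -> vect_ideal (x + y)
| vect_idealM a x b : vect_ideal x -> vect_ideal (a * x * b).

Lemma vect_idealMl a x : vect_ideal x -> vect_ideal (a * x).
Proof. by move=> /(vect_idealM a 1); rewrite mulr1. Qed.

Lemma vect_idealMr x b : vect_ideal x -> vect_ideal (x * b).
Proof. by move=> /(vect_idealM 1 b); rewrite mul1r. Qed.

Lemma vect_idealN x : vect_ideal x -> vect_ideal (- x).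
Proof. by move=> /(vect_idealMl (- 1)); rewrite mulN1r. Qed.

Lemma vect_idealZ c x : vect_ideal x -> vect_ideal (c *: x).
Proof. by move=> /(vect_idealMl (c%:A)); rewrite mulr_algl. Qed.

Definition counit : T -> R := mcoeff mone.

HB.instance Definition _ := GRing.isZmodMorphism.Build T R counit
  (@mcoeffB _ _ _).
HB.instance Definition _ := GRing.isMonoidMorphism.Build T R counit
  (let: (cM, c1) := mcoeff1g_is_multiplicative (fmonom nat) R in (c1, cM)).
HB.instance Definition _ := GRing.isScalable.Build R T R *%R counit
  (fun c x => mcoeffZ c x mone).

Lemma counitL n : counit (freeL n) = 0.
Proof.
rewrite /counit /freeL /letter mcoeffU /fmu fmE (_ : _ == _ = false) //.
by apply/eqP => /(congr1 (@fmonom_val nat)); rewrite fm1.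
Qed.

Lemma vect_ideal_proper x : vect_ideal x -> counit x = 0.
Proof.
have counit_rel (A : lalgType R) (f : {lrmorphism A -> R^o}) a b c k :
    f a = 0 -> f b = 0 -> f c = 0 -> f (a * b - b * a - k *: c) = 0.
  move=> a0 b0 c0.
  by rewrite !raddfB /= linearZ !rmorphM /= a0 b0 c0 !mulr0 scaler0 !subr0.
elim=> [n m _ _||{}x y _ xE _ yE|a {}x b _ xE].
- by apply: (counit_rel T counit); exact: counitL.
- by rewrite raddf0.
- by rewrite raddfD /= xE yE addr0.
- by rewrite !rmorphM /= xE mulr0 mul0r.
Qed.

Definition vect_cong : rel T := fun x y => `[< vect_ideal (x - y) >].

Lemma vect_cong_refl : reflexive vect_cong.
Proof. by move=> x; apply/asboolP; rewrite subrr; exact: vect_ideal0. Qed.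

Lemma vect_cong_sym : symmetric vect_cong.
Proof.
by move=> x y; apply/asboolP/asboolP => /vect_idealN; rewrite opprB.
Qed.

Lemma vect_cong_trans : transitive vect_cong.
Proof.
move=> y x z /asboolP xy /asboolP yz; apply/asboolP.
by rewrite -(subrKA y); exact: vect_idealD.
Qed.

Canonical vect_cong_equiv : equiv_rel T :=
  EquivRel vect_cong vect_cong_refl vect_cong_sym vect_cong_trans.

Definition Uvect : Type := {eq_quot vect_cong}.

HB.instance Definition _ := Choice.on Uvect.
HB.instance Definition _ := EqQuotient.on Uvect.

Definition Upi : T -> Uvect := \pi_Uvect.

Lemma UpiP x y : Upi x = Upi y <-> vect_ideal (x - y).
Proof.
split=> [/eqmodP /asboolP //|xy]; apply/eqmodP; exact/asboolP.
Qed.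

Lemma Upi_repr u : Upi (repr u) = u.
Proof. exact: reprK. Qed.

Definition Uadd (u v : Uvect) : Uvect := Upi (repr u + repr v).
Definition Uopp (u : Uvect) : Uvect := Upi (- repr u).
Definition Umul (u v : Uvect) : Uvect := Upi (repr u * repr v).
Definition Uscale (c : R) (u : Uvect) : Uvect := Upi (c *: repr u).

Lemma reprP x : vect_ideal (repr (Upi x) - x).
Proof. by apply/UpiP; rewrite Upi_repr. Qed.

Lemma UaddE x y : Uadd (Upi x) (Upi y) = Upi (x + y).
Proof.
by apply/UpiP; rewrite opprD addrACA; apply: vect_idealD; exact: reprP.
Qed.

Lemma UoppE x : Uopp (Upi x) = Upi (- x).
Proof. by apply/UpiP; rewrite -opprD; apply: vect_idealN; exact: reprP. Qed.

Lemma UmulE x y : Umul (Upi x) (Upi y) = Upi (x * y).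
Proof.
apply/UpiP; have := reprP x; have := reprP y.
move: (repr (Upi x)) (repr (Upi y)) => x' y' yy xx.
have -> : x' * y' - x * y = x' * (y' - y) + (x' - x) * y.
  by rewrite mulrBr mulrBl addrA subrK.
exact: vect_idealD (vect_idealMl x' yy) (vect_idealMr y xx).
Qed.

Lemma UscaleE c x : Uscale c (Upi x) = Upi (c *: x).
Proof. by apply/UpiP; rewrite -scalerBr; apply: vect_idealZ; exact: reprP. Qed.

Lemma Uind (P : Uvect -> Prop) : (forall x, P (Upi x)) -> forall u, P u.
Proof. by move=> PU u; rewrite -(Upi_repr u). Qed.

Lemma UaddA : associative Uadd.
Proof.
by elim/Uind=> x; elim/Uind=> y; elim/Uind=> z; rewrite !UaddE addrA.
Qed.

Lemma UaddC : commutative Uadd.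
Proof. by elim/Uind=> x; elim/Uind=> y; rewrite !UaddE addrC. Qed.

Lemma Uadd0 : left_id (Upi 0) Uadd.
Proof. by elim/Uind=> x; rewrite UaddE add0r. Qed.

Lemma UaddN : left_inverse (Upi 0) Uopp Uadd.
Proof. by elim/Uind=> x; rewrite UoppE UaddE addNr. Qed.

HB.instance Definition _ :=
  GRing.isZmodule.Build Uvect UaddA UaddC Uadd0 UaddN.

Lemma UmulA : associative Umul.
Proof.
by elim/Uind=> x; elim/Uind=> y; elim/Uind=> z; rewrite !UmulE mulrA.
Qed.

Lemma Umul1 : left_id (Upi 1) Umul.
Proof. by elim/Uind=> x; rewrite UmulE mul1r. Qed.

Lemma U1mul : right_id (Upi 1) Umul.
Proof. by elim/Uind=> x; rewrite UmulE mulr1. Qed.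

Lemma UmulDl : left_distributive Umul +%R.
Proof.
elim/Uind=> x; elim/Uind=> y; elim/Uind=> z.
by rewrite -[LHS]/(Umul (Uadd _ _) _) -[RHS]/(Uadd _ _) !(UaddE, UmulE) mulrDl.
Qed.

Lemma UmulDr : right_distributive Umul +%R.
Proof.
elim/Uind=> x; elim/Uind=> y; elim/Uind=> z.
by rewrite -[LHS]/(Umul _ (Uadd _ _)) -[RHS]/(Uadd _ _) !(UaddE, UmulE) mulrDr.
Qed.

Lemma Uone_neq0 : Upi 1 != 0.
Proof.
apply/eqP => /UpiP /vect_ideal_proper /eqP.
by rewrite subr0 rmorph1 oner_eq0.
Qed.

HB.instance Definition _ := GRing.Zmodule_isNzRing.Build Uvect
  UmulA Umul1 U1mul UmulDl UmulDr Uone_neq0.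

Lemma UscaleA a b u : Uscale a (Uscale b u) = Uscale (a * b) u.
Proof. by elim/Uind: u => x; rewrite !UscaleE scalerA. Qed.

Lemma Uscale1 : left_id 1 Uscale.
Proof. by elim/Uind=> x; rewrite UscaleE scale1r. Qed.

Lemma UscaleDr : right_distributive Uscale +%R.
Proof.
move=> c; elim/Uind=> x; elim/Uind=> y.
by rewrite -[LHS]/(Uscale _ (Uadd _ _)) -[RHS]/(Uadd _ _)
  !(UaddE, UscaleE) scalerDr.
Qed.

Lemma UscaleDl u : {morph Uscale^~ u : a b / a + b}.
Proof.
move=> a b; elim/Uind: u => x.
by rewrite -[RHS]/(Uadd _ _) !(UaddE, UscaleE) scalerDl.
Qed.

HB.instance Definition _ := GRing.Zmodule_isLmodule.Build R Uvect
  UscaleA Uscale1 UscaleDr UscaleDl.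

Lemma UscaleAl (c : R) (u v : Uvect) : c *: (u * v) = (c *: u) * v.
Proof.
elim/Uind: u => x; elim/Uind: v => y.
by rewrite -[LHS]/(Uscale _ (Umul _ _)) -[RHS]/(Umul (Uscale _ _) _)
  !(UmulE, UscaleE) scalerAl.
Qed.

HB.instance Definition _ := GRing.Lmodule_isLalgebra.Build R Uvect UscaleAl.

Lemma UscaleAr (c : R) (u v : Uvect) : c *: (u * v) = u * (c *: v).
Proof.
elim/Uind: u => x; elim/Uind: v => y.
by rewrite -[LHS]/(Uscale _ (Umul _ _)) -[RHS]/(Umul _ (Uscale _ _))
  !(UmulE, UscaleE) scalerAr.
Qed.

HB.instance Definition _ := GRing.Lalgebra_isAlgebra.Build R Uvect UscaleAr.

Lemma Upi_zmod_morphism : zmod_morphism Upi.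
Proof. by move=> x y; rewrite -UaddE -UoppE. Qed.

Lemma Upi_monoid_morphism : monoid_morphism Upi.
Proof. by split=> [|x y]; [exact: erefl | exact/esym/UmulE]. Qed.

Lemma Upi_scalable : scalable Upi.
Proof. by move=> c x; exact/esym/UscaleE. Qed.

HB.instance Definition _ := GRing.isZmodMorphism.Build T Uvect Upi
  Upi_zmod_morphism.
HB.instance Definition _ := GRing.isMonoidMorphism.Build T Uvect Upi
  Upi_monoid_morphism.
HB.instance Definition _ := GRing.isScalable.Build R T Uvect _ Upi
  Upi_scalable.

Definition UL (n : nat) : Uvect := Upi (freeL n).

Lemma UL_comm n m : (0 < n)%N -> (0 < m)%N ->
  UL n * UL m - UL m * UL n = (m%:R - n%:R) *: UL (m + n).
Proof.
move=> n0 m0; rewrite -!rmorphM -rmorphB -linearZ; apply/UpiP.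
exact: vect_ideal_rel.
Qed.

(* U^(n): the image of the combinations of words of weight n.                 *)
Definition word_weight (m : fmonom nat) : nat :=
  (\sum_(i <- fmonom_val m) i.+1)%N.

Definition Udeg (n : nat) : set Uvect :=
  [set Upi x | x in [set x : T | forall m, m \in msupp x -> word_weight m = n]].

Definition Ubar : set (nat -> Uvect) := [set u | forall n, Udeg n (u n)].

(* omega_1, omega_2 are the letters 0, 1 of 'I_2.                             *)
Definition A2_pi : free_alg R 'I_2 -> Uvect := free_eval (fun i : 'I_2 => UL i.+1).

Definition A2_norm (w : free_alg R 'I_2) : R := \sum_(m <- msupp w) `|mcoeff m w|.

(* The infimum is a minimum: A2_pi is surjective and graded, with             *)
(* finite-dimensional graded components.                                      *)
Definition Q1 (u : Uvect) : R := inf [set A2_norm w | w in [set w | A2_pi w = u]].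

Definition Ubrack (t : R) : set (nat -> Uvect) :=
  [set u | Ubar u /\ (\sum_(0 <= n <oo) (t ^+ n * Q1 (u n))%:E < +oo)%E].

End Enveloping.

(* A formal series over a ring, or an element of a completed graded algebra,  *)
(* is the sequence of its components; cauchy is the product.                  *)
Definition cauchy (A : pzRingType) (a b : nat -> A) : nat -> A :=
  fun n => \sum_(i < n.+1) a i * b (n - i)%N.

Definition series_pow (A : pzRingType) (a : nat -> A) (k : nat) : nat -> A :=
  iter k (cauchy a) (fun n => (n == 0)%:R).

Section Diffeomorphisms.
Variable R : realType.

(* gamma n is the coefficient of x^n.                                         *)
Definition Diffbar : set (nat -> R) :=
  [set gamma | gamma 0%N = 0 /\ gamma 1%N = 1].

Definition Diff (s : R) : set (nat -> R) :=
  [set gamma | Diffbar gamma /\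
    (\sum_(2 <= j <oo) (`|gamma j| * s ^+ j.-1 / j`!%:R)%:E < +oo)%E].

(* F(gamma(x)); gamma^k has order >= k, so that the powers k > n do not       *)
(* contribute to the coefficient of x^n.                                      *)
Definition series_comp (F gamma : nat -> R) : nat -> R :=
  fun n => \sum_(k < n.+1) F k * series_pow gamma k n.

(* p n is the coefficient of L_n.                                             *)
Definition vectbar : set (nat -> R) := [set p | p 0%N = 0].

(* \sum_j p_j L_j as an operator on R[[x]], where L_j x^i = i x^(i+j).        *)
Definition vect_act (p F : nat -> R) : nat -> R :=
  fun n => \sum_(1 <= j < n.+1) p j * ((n - j)%:R * F (n - j)%N).

(* As vect_act p raises the order, the terms k > n of the exponential series  *)
(* do not contribute to the coefficient of x^n.                               *)
Definition exp_act (p F : nat -> R) : nat -> R :=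
  fun n => \sum_(k < n.+1) k`!%:R^-1 * iter k (vect_act p) F n.

(* The exponential of \sum_j p_j L_j in the completion of U(vect); its powers *)
(* k > n have no component of degree n.                                       *)
Definition exp_U (p : nat -> R) : nat -> Uvect R :=
  fun n => \sum_(k < n.+1)
    k`!%:R^-1 *: series_pow (fun j => p j *: UL R j) k n.

(* gamma corresponds to \sum_j p_j L_j.                                       *)
Definition is_exp_of (gamma p : nat -> R) : Prop :=
  forall F : nat -> R, exp_act p F = series_comp F gamma.

Definition Diff_brack (t : R) : set (nat -> R) :=
  [set gamma | Diffbar gamma /\
    exists p, [/\ vectbar p, is_exp_of gamma p & Ubrack t (exp_U p)]].

End Diffeomorphisms.

(* Main.v *)
Require Import Defs.
From HB Require Import structures.
From mathcomp Require Import all_boot all_order all_algebra.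
From mathcomp Require Import finmap ring lra zify.
From mathcomp Require Import boolp classical_sets reals ereal normedtype.
From mathcomp Require Import sequences.
From mathcomp Require Import -(notations) monalg.

Set Implicit Arguments.
Unset Strict Implicit.
Unset Printing Implicit Defensive.

Import Order.TTheory GRing.Theory Num.Theory.
Local Open Scope ring_scope.
Local Open Scope classical_set_scope.

(** If [u = exp p] and [D] is the derivation [L_n |-> n L_n], then
    [D u = l u] with [l = \sum_n q_n L_n] in the completed Lie algebra, that
    is, [n u_n = \sum_j q_j L_j u_(n-j)]; on power series this reads
    [n a_(n+1) = \sum_j q_j (n-j+1) a_(n-j+1)]. Because of the factor [n] on
    the left and of the inverse binomials that come with the weights
    [s^n / n!], a Gronwall argument bounds [u] or [a] by [q] and [q] by [a].
    Up to a polynomial in [n], [Q_1(L_n)] is [2^n / n!]. The upper bound comes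
    from [L_(m+1) = [L_1, L_m] / (m-1)]. For the lower bound, and hence for
    the bound of [q] by [u], one reads the entry in degree [n] of
    [D u * u^-1 = l] on [x^c, ..., x^(c+n)] with [c = -n/2], where every word
    in [L_1], [L_2] has entries of size about [n! / 2^n]; [u^-1] is controlled
    by letting [u] act on the dual module. *)

(** * Triangular sums, bounded partial sums and the Gronwall estimate *)

Lemma sum_antidiag (V : nmodType) (f : nat -> nat -> V) N :
  \sum_(n < N) \sum_(j < n.+1) f j (n - j)%N =
  \sum_(j < N) \sum_(m < N - j) f j m.
Proof.
have -> : \sum_(n < N) \sum_(j < n.+1) f j (n - j)%N =
          \sum_(j < N) \sum_(n < N | (j <= n)%N) f j (n - j)%N.
  rewrite (exchange_big_dep predT) //=; apply: eq_bigr => n _.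
  by rewrite (big_ord_widen N (fun j => f j (n - j)%N)) //; exact: eq_bigl.
apply: eq_bigr => j _.
rewrite -(big_mkord (fun n => j <= n)%N (fun n => f j (n - j)%N)).
rewrite (big_cat_nat (n := j)) //=; last exact: ltnW.
rewrite big_nat_cond big_pred0 ?add0r; last first.
  by move=> n /=; case: ltnP; rewrite ?andbF // => /ltnW; lia.
rewrite -{1}[j : nat]add0n big_addn -[RHS](big_mkord xpredT) [LHS]big_mkcond.
by apply: eq_bigr => n _; rewrite leq_addl addnK.
Qed.

Section BoundedSums.
Variable R : realType.
Implicit Types x b w : nat -> R.

(** For nonnegative terms this is summability, in a form that keeps the estimates in [R]. *)
Definition bounded_sums x := exists M, forall N, \sum_(n < N) x n <= M.

Lemma bounded_sums_ereal m x : (forall n, 0 <= x n) ->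
  (\sum_(m <= n <oo) (x n)%:E < +oo)%E <-> bounded_sums (fun n => x (m + n)%N).
Proof.
move=> x0.
have S0 N : ((\sum_(m <= n < N) x n)%:E <= \sum_(m <= n <oo) (x n)%:E)%E.
  by rewrite -sumEFin; apply: nneseries_lim_ge => n _; rewrite lee_fin.
have shift N : \sum_(m <= n < N) x n = \sum_(n < N - m) x (m + n)%N.
  rewrite -{1}[m]add0n big_addn big_mkord.
  by apply: eq_bigr => n _; rewrite addnC.
split=> [|[M xM]]; last first.
  apply: (@le_lt_trans _ _ M%:E); last exact: ltry.
  apply: lime_le; first by apply: is_cvg_nneseries => n _ _; rewrite lee_fin.
  by apply: nearW => N; rewrite sumEFin lee_fin shift.
move: S0; case: (\sum_(m <= n <oo) _)%E => [M S0 _|//|S0 _].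
  by exists M => N; have := S0 (m + N)%N; rewrite lee_fin shift addKn.
by have := S0 0%N.
Qed.

Lemma bounded_sumsZ c x y : 0 <= c -> (forall n, 0 <= x n) ->
  (forall n, y n <= c * x n) -> bounded_sums x -> bounded_sums y.
Proof.
move=> c0 x0 yx [M xM]; exists (c * M) => N.
apply: le_trans (ler_wpM2l c0 (xM N)); rewrite mulr_sumr.
by apply: ler_sum => n _; exact: yx.
Qed.

Lemma conv_sum_le x w N : (forall n, 0 <= x n) -> (forall n, 0 <= w n) ->
  \sum_(n < N) \sum_(j < n.+1) x j * w (n - j)%N <=
  (\sum_(j < N) x j) * \sum_(j < N) w j.
Proof.
move=> x0 w0; rewrite (sum_antidiag (fun j m => x j * w m)) mulr_suml.
apply: ler_sum => j _; rewrite -mulr_sumr; apply: ler_wpM2l => //.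
rewrite -!(big_mkord xpredT w) [leRHS](big_cat_nat (n := (N - j)%N)) ?leq_subr //=.
by rewrite lerDl; apply: sumr_ge0.
Qed.

Lemma bounded_sums_conv x w : (forall n, 0 <= x n) -> (forall n, 0 <= w n) ->
  bounded_sums x -> bounded_sums w ->
  bounded_sums (fun n => \sum_(j < n.+1) x j * w (n - j)%N).
Proof.
move=> x0 w0 [M xM] [M' wM]; exists (M * M') => N.
apply: le_trans (conv_sum_le N x0 w0) _.
by apply: ler_pM => //; apply: sumr_ge0.
Qed.

(* The factor 1/n makes the convolution term at most half of the left-hand    *)
(* side beyond some rank, whatever the size of w.                             *)
Lemma bounded_sums_gronwall x b w : (forall n, 0 <= x n) ->
  (forall n, 0 <= b n) -> (forall n, 0 <= w n) ->
  bounded_sums b -> bounded_sums w ->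
  (forall n, (0 < n)%N -> x n <= b n + n%:R^-1 * \sum_(j < n) x j * w (n - j)%N) ->
  bounded_sums x.
Proof.
move=> x0 b0 w0 [B bB] [W wW] rec.
have W0 : 0 <= W by apply: le_trans (wW 0%N); rewrite big_ord0.
have [n0 n0W] : exists n0 : nat, 2 * W + 1 <= n0%:R.
  exists (Num.bound (2 * W + 1)); apply: ltW; apply: archi_boundP; lra.
have n0p : 0 < n0%:R :> R by apply: lt_le_trans n0W; lra.
(* The constant comes from solving [S <= A + S / 2] for a partial sum [S]. *)
exists (2 * (\sum_(n < n0) x n + B)) => N.
have [Nn0|n0N] := leqP N n0.
  have B0 : 0 <= B by apply: le_trans (bB 0%N); rewrite big_ord0.
  have S0 : 0 <= \sum_(n < n0) x n by apply: sumr_ge0.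
  apply: (@le_trans _ _ (\sum_(n < n0) x n)); last lra.
  rewrite -!(big_mkord xpredT x) [leRHS](big_cat_nat (n := N)) //=.
  by rewrite lerDl; apply: sumr_ge0.
pose S := \sum_(n < N) x n.
have S0 : 0 <= S by apply: sumr_ge0.
suff : S <= \sum_(n < n0) x n + (B + n0%:R^-1 * (S * W)).
  suff : n0%:R^-1 * (S * W) <= S / 2 by rewrite -/S; lra.
  rewrite ler_pdivrMl // [leRHS]mulrCA; apply: ler_wpM2l => //; lra.
rewrite {1}/S -(big_mkord xpredT x) (big_cat_nat (n := n0)) //=; last exact: ltnW.
rewrite big_mkord lerD2l.
apply: (@le_trans _ _ (\sum_(n0 <= n < N)
    (b n + n0%:R^-1 * \sum_(j < n.+1) x j * w (n - j)%N))).
  rewrite !big_nat; apply: ler_sum => n /andP[n0n _].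
  have np : (0 < n)%N by apply: leq_trans n0n; rewrite -(ltr0n R).
  apply: le_trans (rec n np) _; rewrite lerD2l.
  apply: ler_pM; rewrite ?invr_ge0 ?ler0n //.
  - by apply: sumr_ge0 => j _; apply: mulr_ge0.
  - by rewrite lef_pV2 ?posrE ?ltr0n ?ler_nat // -(ltr0n R).
  - by rewrite big_ord_recr /= lerDl mulr_ge0.
rewrite big_split /= -mulr_sumr lerD //.
  apply: le_trans (bB N); rewrite -(big_mkord xpredT b).
  by rewrite [leRHS](big_cat_nat (n := n0)) //= ?(ltnW n0N) // lerDr sumr_ge0.
rewrite ler_wpM2l ?invr_ge0 ?ler0n //.
apply: (@le_trans _ _ (\sum_(n < N) \sum_(j < n.+1) x j * w (n - j)%N)).
  rewrite -[leRHS](big_mkord xpredT (fun n => \sum_(j < n.+1) x j * w (n - j)%N)).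
  rewrite [leRHS](big_cat_nat (n := n0)) //= ?(ltnW n0N) // lerDr.
  by do 2![apply: sumr_ge0 => ? _]; apply: mulr_ge0.
by apply: le_trans (conv_sum_le N x0 w0) _; apply: ler_wpM2l.
Qed.

(** Bernoulli's inequality [r^-n >= 1 + n h], with [h = r^-1 - 1], dominates [n + 1] up to the
    factor [1 + h^-1]. *)
Lemma linear_expr_bounded (r : R) : 0 < r < 1 ->
  exists2 C, 0 < C & forall n, n.+1%:R * r ^+ n <= C.
Proof.
move=> /andP[r0 r1]; pose h := r^-1 - 1.
have rV1 : 1 < r^-1 by rewrite invf_gt1.
have h0 : 0 < h by rewrite /h; lra.
exists (1 + h^-1); first by rewrite addr_gt0 // invr_gt0.
move=> n; rewrite -ler_pdivlMr ?exprn_gt0 // -exprVn.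
apply: (@le_trans _ _ ((1 + h^-1) * (1 + n%:R * h))).
  rewrite mulrDl mul1r [h^-1 * _]mulrDr mulr1 [h^-1 * _]mulrCA mulVf ?gt_eqF //.
  have : 0 <= n%:R * h by rewrite mulr_ge0 // ltW.
  have : 0 < h^-1 by rewrite invr_gt0.
  rewrite -natr1; lra.
apply: ler_wpM2l; first by rewrite addr_ge0 // invr_ge0 ltW.
elim: n => [|n IHn]; first by rewrite mul0r addr0 expr0.
have rE : r^-1 = 1 + h by rewrite /h; lra.
rewrite exprS -natr1 rE; rewrite rE in IHn.
apply: le_trans (ler_wpM2l _ IHn); last by lra.
have : 0 <= n%:R :> R by []. nra.
Qed.

Lemma quadratic_expr_bounded (r : R) : 0 < r < 1 ->
  exists2 C, 0 < C & forall n, n.+1%:R ^+ 2 * r ^+ n <= C.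
Proof.
move=> /andP[r0 r1].
have /linear_expr_bounded[C C0 rC] : 0 < Num.sqrt r < 1.
  by rewrite sqrtr_gt0 r0 -sqrtr1 ltr_sqrt.
exists (C ^+ 2) => [|n]; first exact: exprn_gt0.
have -> : r ^+ n = (Num.sqrt r ^+ n) ^+ 2.
  by rewrite -exprM mulnC exprM sqr_sqrtr // ltW.
by rewrite -exprMn lerXn2r ?nnegrE ?mulr_ge0 ?exprn_ge0 ?sqrtr_ge0 ?(ltW C0).
Qed.

End BoundedSums.

(** Course-of-values recursion: [s n] lists the first [n] values, and [Phi] at [n] only sees
    arguments below [n], so the list may be replaced by the function it builds. *)
Lemma nat_strong_rec (T : Type) (x0 : T) (Phi : (nat -> T) -> nat -> T) :
  (forall f g n, (forall i, (i < n)%N -> f i = g i) -> Phi f n = Phi g n) ->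
  exists f, forall n, f n = Phi f n.
Proof.
move=> PhiE; pose s n := iter n (fun l => rcons l (Phi (nth x0 l) (size l))) [::].
have size_s n : size (s n) = n by elim: n => //= n IHn; rewrite size_rcons IHn.
have nth_s n m i : (i < n)%N -> (n <= m)%N -> nth x0 (s m) i = nth x0 (s n) i.
  move=> ni /subnKC <-; elim: (m - n)%N => [|k IHk]; first by rewrite addn0.
  by rewrite addnS /= nth_rcons size_s (leq_trans ni) ?leq_addr.
exists (fun n => nth x0 (s n.+1) n) => n.
rewrite {1}/s /= -/(s n) nth_rcons size_s ltnn eqxx; apply: PhiE => i ni.
by apply: (nth_s i.+1).
Qed.

(** * Commutators and derivatives of powers over a noncommutative ring *)

Section Adjoint.
Variable B : pzRingType.
Implicit Types P Z : B.

Definition ad P Z := P * Z - Z * P.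

(** Left multiplication by [P] is [ad P] plus right multiplication by [P]; these two commute, hence
    a binomial formula. *)
Lemma expr_mul_ad P Z k :
  P ^+ k * Z = \sum_(K < k.+1) (iter K (ad P) Z * P ^+ (k - K)) *+ 'C(k, K).
Proof.
elim: k => [|k IHk]; first by rewrite big_ord1 /= expr0 mulr1 mul1r bin0.
rewrite exprS -mulrA IHk mulr_sumr.
transitivity (\sum_(K < k.+1) (iter K.+1 (ad P) Z * P ^+ (k - K)) *+ 'C(k, K)
  + \sum_(K < k.+2) (iter K (ad P) Z * P ^+ (k.+1 - K)) *+ 'C(k, K)).
  rewrite [X in _ + X]big_ord_recr /= bin_small // mulr0n addr0 -big_split /=.
  apply: eq_bigr => K _; rewrite -mulrnDl mulrnAr; congr (_ *+ _).
  rewrite {1}/ad mulrBl subSn -1?ltnS // exprS !mulrA.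
  by rewrite subrK.
rewrite [X in _ + X]big_ord_recl [RHS]big_ord_recl /= !bin0 addrCA; congr (_ + _).
rewrite -big_split /=; apply: eq_bigr => K _.
by rewrite /bump /= add1n subSS binS -mulrnDr addnC.
Qed.

End Adjoint.

(** The derivative is the sum of the [P^i P' P^(k-1-i)]; moving the left powers to the right by
    [expr_mul_ad] produces [\sum_(i < k) C(i, K) = C(k, K+1)]. *)
Lemma deriv_exp_ad (A : nzRingType) (P : {poly A}) k :
  (P ^+ k)^`() =
  \sum_(K < k) (iter K (ad P) P^`() * P ^+ (k.-1 - K)) *+ 'C(k, K.+1).
Proof.
elim: k => [|k IHk]; first by rewrite expr0 derivC big_ord0.
rewrite exprSr derivM IHk expr_mul_ad mulr_suml.
transitivity (\sum_(K < k.+1) (iter K (ad P) P^`() * P ^+ (k - K)) *+ 'C(k, K.+1)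
  + \sum_(K < k.+1) (iter K (ad P) P^`() * P ^+ (k - K)) *+ 'C(k, K)).
  congr (_ + _); rewrite big_ord_recr /= bin_small // mulr0n addr0.
  apply: eq_bigr => -[K /= Kk] _; rewrite mulrnAl -mulrA -exprSr.
  by congr (_ * _ ^+ _ *+ _); lia.
by rewrite -big_split; apply: eq_bigr => K _; rewrite /= -mulrnDr binS.
Qed.

(** * The formal exponential and its logarithmic derivative *)

Section FormalExp.
Variable R : realType.

(** Coefficients of [[\sum_i p_i L_i, \sum_j z_j L_j]], with [[L_i, L_j] = (j - i) L_(i+j)]; the
    range leaves out [z 0], which belongs to no [L_j]. *)
Definition bracket_seq (p z : nat -> R) : nat -> R :=
  fun d => \sum_(i < d) p i * z (d - i)%N * ((d - i)%:R - i%:R).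

Definition ad_iter (p : nat -> R) (K : nat) : nat -> R :=
  iter K (bracket_seq p) (fun d => d%:R * p d).

(* With D the derivation L_n |-> n L_n, the coefficients of                   *)
(* D(exp p) exp(-p) = \sum_K ad_p^K(D p) / (K+1)!.                            *)
Definition exp_logderiv (p : nat -> R) : nat -> R :=
  fun n => \sum_(K < n) (K.+1)`!%:R^-1 * ad_iter p K n.

(** [D p] starts in degree 1 and each bracket with [p] raises the degree, so the range [K < n] in
    [exp_logderiv] loses nothing. *)
Lemma ad_iter_small p K d : p 0%N = 0 -> (d <= K)%N -> ad_iter p K d = 0.
Proof.
move=> p0; elim: K d => [|K IHK] d dK.
  by rewrite leqn0 in dK; rewrite /ad_iter /= (eqP dK) mul0r.
rewrite /ad_iter iterS /bracket_seq big1 // => -[[|i] id] _ /=; first by rewrite p0 !mul0r.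
by rewrite -/(ad_iter p K) IHK ?mulr0 ?mul0r //; lia.
Qed.

Definition vect_relation (A : algType R) (X : nat -> A) :=
  forall n m, (0 < n)%N -> (0 < m)%N ->
    X n * X m - X m * X n = (m%:R - n%:R) *: X (m + n)%N.

Variables (A : algType R) (X : nat -> A).

(** The formula of [exp_U] for an arbitrary family [X], so that one recursion serves [U(vect)],
    power series and matrices. *)
Definition fexp (p : nat -> R) : nat -> A :=
  fun n => \sum_(k < n.+1)
    k`!%:R^-1 *: series_pow (fun j => p j *: X j) k n.

(** Truncation turns components into coefficients of polynomials, where derivatives and ring
    identities are available. *)
Lemma series_powE (B : nzRingType) (a : nat -> B) N k n : (n <= N)%N ->
  series_pow a k n = ((\poly_(j < N.+1) a j) ^+ k)`_n.
Proof.
elim: k n => [|k IHk] n nN; first by rewrite expr0 coef1.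
rewrite exprS coefM /series_pow /=; apply: eq_bigr => -[i /= ilt] _.
rewrite -/(series_pow a k) IHk ?coef_poly; last lia.
by rewrite ifT //; lia.
Qed.

Lemma coef_exp_small (B : nzRingType) (P : {poly B}) k n :
  P`_0 = 0 -> (n < k)%N -> (P ^+ k)`_n = 0.
Proof.
move=> P0; elim: k n => // k IHk n nk.
rewrite exprS coefM big1 // => -[[|i] /= ilt] _; first by rewrite P0 mul0r.
by rewrite IHk ?mulr0 //; lia.
Qed.

Lemma fexp0 p : fexp p 0 = 1.
Proof. by rewrite /fexp big_ord1 /= fact0 invr1 scale1r. Qed.

Lemma fexpE p N n : p 0%N = 0 -> (n <= N)%N ->
  fexp p n = \sum_(k < N.+1)
    k`!%:R^-1 *: ((\poly_(j < N.+1) (p j *: X j)) ^+ k)`_n.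
Proof.
move=> p0 nN; rewrite /fexp (big_ord_widen N.+1 (fun k =>
  k`!%:R^-1 *: series_pow (fun j => p j *: X j) k n)) // big_mkcond /=.
apply: eq_bigr => k _; rewrite -(series_powE _ _ nN).
case: ifPn => //; rewrite -leqNgt => nk.
rewrite (series_powE _ _ nN) coef_exp_small ?scaler0 //.
by rewrite coef_poly /= p0 scale0r.
Qed.

Hypothesis XP : vect_relation X.

Lemma coef_ad_iter p N K j : p 0%N = 0 -> (j < N)%N ->
  (iter K (ad (\poly_(j < N.+1) (p j *: X j)))
     (\poly_(j < N.+1) (p j *: X j))^`())`_j = ad_iter p K j.+1 *: X j.+1.
Proof.
move=> p0; set P := \poly_(j < N.+1) _.
elim: K j => [|K IHK] j jN.
  by rewrite coef_deriv coef_poly ltnS jN -scaler_nat scalerA.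
rewrite /ad_iter !iterS -/(ad_iter p K) /bracket_seq /ad coefB coefM coefMr -sumrB scaler_suml.
apply: eq_bigr => -[i /= ij] _.
rewrite IHK; last lia. rewrite coef_poly ifT; last lia.
case: i ij => [|i] ij; first by rewrite p0 scale0r mul0r mulr0 subrr !mul0r scale0r.
rewrite -!(scalerAl, scalerAr) [_ *: (_ *: (X _ * X i.+1))]scalerA.
rewrite scalerA [_ * p i.+1]mulrC -scalerBr XP ?subn_gt0 // scalerA subnSK // subSS.
by congr (_ *: X _); lia.
Qed.

(** This is [D(exp p) = l exp p]: after [deriv_exp_ad] the coefficient [C(k, K+1) / k!] splits as
    [1 / ((K+1)! (k-K-1)!)], so the double sum factors into [\sum_K ad_p^K(D p) / (K+1)!] times
    [exp p]. *)
Lemma fexp_rec p n : p 0%N = 0 ->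
  n%:R *: fexp p n =
  \sum_(j < n) exp_logderiv p (n - j) *: (X (n - j)%N * fexp p j).
Proof.
move=> p0; case: n => [|n]; first by rewrite scale0r big_ord0.
rewrite (fexpE p0 (leqnn _)); set P := \poly_(j < _) _.
have P0 : P`_0 = 0 by rewrite coef_poly /= p0 scale0r.
pose f K m := ((K.+1)`!%:R^-1 * m`!%:R^-1) *:
  (iter K (ad P) P^`() * P ^+ m)`_n.
have adP K i : (i < n.+1)%N ->
    (iter K (ad P) P^`())`_i = ad_iter p K i.+1 *: X i.+1.
  exact: coef_ad_iter.
have f0 K m : (n < K + m)%N -> f K m = 0.
  move=> nKm; rewrite /f coefM big1 ?scaler0 // => -[i /= ilt] _.
  rewrite adP //; have [iK|Ki] := ltnP i K.
    by rewrite ad_iter_small // scale0r mul0r.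
  by rewrite coef_exp_small ?mulr0 //; lia.
transitivity (\sum_(k < n.+1) \sum_(K < k.+1) f K (k - K)%N).
  rewrite scaler_sumr big_ord_recl expr0 coef1 /= !scaler0 add0r.
  apply: eq_bigr => k _; rewrite /bump /= add1n.
  rewrite scalerA mulrC -scalerA scaler_nat -coef_deriv deriv_exp_ad coef_sum.
  rewrite scaler_sumr; apply: eq_bigr => -[K /= Kk] _.
  rewrite coefMn -scaler_nat scalerA; congr (_ *: _).
  have /(congr1 (fun x => x%:R : R)) := bin_fact Kk.
  rewrite subSS !natrM => <-.
  rewrite invfM mulrAC mulVf ?mul1r ?invfM //.
  by rewrite pnatr_eq0 -lt0n bin_gt0.
(* By [f0] the triangle may be completed to a square, on which the sums over [K] and [m]
   separate. *)
transitivity (\sum_(K < n.+1) \sum_(m < n.+1) f K m).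
  rewrite sum_antidiag; apply: eq_bigr => -[K /= Kn] _.
  rewrite (big_ord_widen n.+1 (f K)) ?leq_subr // big_mkcond /=.
  by apply: eq_bigr => -[m /= mn] _; case: ifPn => // ?; rewrite f0 //; lia.
under eq_bigr do under eq_bigr do rewrite /f coefMr scaler_sumr.
under eq_bigr do rewrite exchange_big.
rewrite exchange_big; apply: eq_bigr => -[j /= jn] _.
rewrite (@fexpE p n.+1 j p0) ?(ltnW jn) // -/P [X in _ = _ *: (_ * X)]big_ord_recr /=.
rewrite coef_exp_small // scaler0 addr0.
rewrite /exp_logderiv (big_ord_widen n.+1 (fun K =>
  (K.+1)`!%:R^-1 * ad_iter p K (n.+1 - j)%N)) ?leq_subr //.
rewrite scaler_suml [RHS]big_mkcond; apply: eq_bigr => K _ /=.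
rewrite adP ?ltnS ?leq_subr // -subSn -1?ltnS //.
case: ifPn => [_|]; last first.
  by rewrite -leqNgt => Kj; rewrite big1 ?scale0r // => m _;
    rewrite ad_iter_small // scale0r mul0r scaler0.
rewrite !mulr_sumr scaler_sumr; apply: eq_bigr => m _.
rewrite -!(scalerAl, scalerAr) !scalerA; congr (_ *: _).
by rewrite mulrAC.
Qed.

End FormalExp.

Lemma sum_triangle_swap (V : nmodType) (f : nat -> nat -> V) N :
  \sum_(j < N) \sum_(m < N - j) f j m = \sum_(m < N) \sum_(j < N - m) f j m.
Proof.
transitivity (\sum_(j < N) \sum_(m < N | (m < N - j)%N) f j m).
  by apply: eq_bigr => j _; rewrite (big_ord_widen N (f j)) ?leq_subr.
rewrite (exchange_big_dep predT) //=; apply: eq_bigr => m _.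
rewrite (big_ord_widen N (f^~ m)) ?leq_subr //.
by apply: eq_bigl => j; lia.
Qed.

(** * The logarithmic derivative recovered from a solution and its inverse *)

Section InverseLogderiv.
Variables (R : realType) (A : algType R) (l u v : nat -> A).
Hypotheses (u0 : u 0%N = 1) (v0 : v 0%N = 1).
Hypothesis uE : forall n, n%:R *: u n = \sum_(j < n) l (n - j)%N * u j.
Hypothesis vE : forall n, n%:R *: v n = - \sum_(j < n) v j * l (n - j)%N.

(** Up to degree [n], [W = U V] satisfies [x W' = [L, W]] with constant term 1, which forces
    [W = 1]; then [(x U') V = L W] is [L]. *)
Lemma logderiv_mul_inv n : (0 < n)%N ->
  \sum_(i < n.+1) i%:R *: (u i * v (n - i)%N) = l n.
Proof.
(* With constant term 0 in [L], the sums over [j < n] are full coefficients of [L U] and [V L]. *)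
pose L := \poly_(i < n.+1) (if i == 0%N then 0 else l i).
pose U := \poly_(i < n.+1) u i; pose V := \poly_(i < n.+1) v i.
have coefXD (P : {poly A}) m : ('X * P^`())`_m = m%:R *: P`_m.
  rewrite coefXM; case: m => [|m] /=; first by rewrite scale0r.
  by rewrite coef_deriv scaler_nat.
have UE m : (m <= n)%N -> ('X * U^`())`_m = (L * U)`_m.
  move=> mn; rewrite coefXD coef_poly ltnS mn uE coefMr big_ord_recr /=.
  rewrite subnn coef_poly /= mul0r addr0; apply: eq_bigr => -[j /= jm] _.
  rewrite coef_poly ifT; last lia. rewrite ifF; last lia.
  by rewrite coef_poly ifT //; lia.
have VE m : (m <= n)%N -> ('X * V^`())`_m = - (V * L)`_m.
  move=> mn; rewrite coefXD coef_poly ltnS mn vE coefM big_ord_recr /=.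
  rewrite subnn [L`_0]coef_poly /= mulr0 addr0; congr (- _).
  apply: eq_bigr => -[j /= jm] _; rewrite coef_poly ifT; last lia.
  rewrite coef_poly ifT; last lia. by rewrite ifF //; lia.
have XUV m : (m <= n)%N -> ('X * U^`() * V)`_m = (L * (U * V))`_m.
  move=> mn; rewrite mulrA !coefM; apply: eq_bigr => -[i /= im] _.
  by rewrite UE //; lia.
have UXV m : (m <= n)%N -> (U * ('X * V^`()))`_m = - (U * V * L)`_m.
  move=> mn; rewrite -mulrA !coefM -sumrN; apply: eq_bigr => -[i /= im] _.
  by rewrite VE ?mulrN //; lia.
have W0 : (U * V)`_0 = 1 by rewrite coefM big_ord1 !coef_poly /= u0 v0 mulr1.
have WE m : (m <= n)%N -> m%:R *: (U * V)`_m = (L * (U * V) - U * V * L)`_m.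
  move=> mn; rewrite -coefXD derivM mulrDr coefD mulrA XUV // coefB.
  rewrite (_ : 'X * (U * V^`()) = U * ('X * V^`())) ?UXV //.
  by rewrite mulrA -commr_polyX mulrA.
(* [L] has no constant term and [W_0 = 1] commutes with [L], so the commutator in degree [m]
   involves only the [W_i] with [0 < i < m]. *)
have W_small m : (0 < m <= n)%N -> (U * V)`_m = 0.
  elim/ltn_ind: m => m IHm /andP[m0 mn].
  suff : m%:R *: (U * V)`_m = 0.
    by move=> /eqP; rewrite scaler_eq0 pnatr_eq0 gtn_eqF //= => /eqP.
  rewrite WE // coefB coefMr coefM -sumrB big1 // => -[[|i] /= im] _.
    by rewrite W0 mulr1 mul1r subrr.
  have [->|im'] := eqVneq i.+1 m; first by rewrite subnn coef_poly /= mulr0 mul0r subrr.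
  by rewrite IHm ?mulr0 ?mul0r ?subrr //; lia.
move=> n0; transitivity (('X * U^`() * V)`_n).
  rewrite coefM; apply: eq_bigr => -[i /= im] _.
  by rewrite coefXD !coef_poly im ltnS leq_subr scalerAl.
rewrite XUV // coefMr big_ord_recl W0 mulr1 subn0 coef_poly ltnSn gtn_eqF //.
rewrite big1 ?addr0 // => -[i /= im] _; rewrite /bump /= add1n W_small ?mulr0 //.
Qed.

End InverseLogderiv.

(** * Matrices of vect on truncated spans of powers of x *)

Section DensityModule.
Variables (R : realType) (N : nat) (c : R).

(* L_n acting on the span of x^c, x^(c+1), ..., x^(c+N).                      *)
Definition Lmx (n : nat) : 'M[R]_N.+1 :=
  \matrix_(a, b) if a == (b + n)%N :> nat then b%:R + c else 0.

(** Entries are indexed by [nat] to allow arithmetic on degrees; [inord] sends an index above [N] to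
    0, hence the bounds in the lemmas below. *)
Definition mxe (M : 'M[R]_N.+1) (a b : nat) : R := M (inord a) (inord b).

Lemma mxeD M M' a b : mxe (M + M') a b = mxe M a b + mxe M' a b.
Proof. by rewrite /mxe mxE. Qed.

Lemma mxe0 a b : mxe 0 a b = 0.
Proof. by rewrite /mxe mxE. Qed.

Lemma mxeZ x M a b : mxe (x *: M) a b = x * mxe M a b.
Proof. by rewrite /mxe mxE. Qed.

Lemma mxe_sum I (r : seq I) (P : pred I) (F : I -> 'M[R]_N.+1) a b :
  mxe (\sum_(i <- r | P i) F i) a b = \sum_(i <- r | P i) mxe (F i) a b.
Proof. by rewrite /mxe summxE. Qed.

Lemma mxe_mul (M M' : 'M[R]_N.+1) a b :
  mxe (M * M') a b = \sum_(k < N.+1) mxe M a k * mxe M' k b.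
Proof. by rewrite /mxe !mxE; apply: eq_bigr => k _; rewrite inord_val. Qed.

Lemma mxe1 (k a b : nat) : (a <= N)%N -> (b <= N)%N ->
  mxe k%:R a b = k%:R * (a == b)%:R.
Proof.
move=> aN bN; rewrite /mxe -mulr_natl mulr_natl -scaler_nat mxE mxE.
by rewrite -val_eqE /= !inordK.
Qed.

Lemma mxe_Lmx n a b : (a <= N)%N -> (b <= N)%N ->
  mxe (Lmx n) a b = if a == (b + n)%N then b%:R + c else 0.
Proof. by move=> aN bN; rewrite /mxe mxE !inordK. Qed.

Lemma mxe_Lmx_mul n M a b : (n <= a <= N)%N ->
  mxe (Lmx n * M) a b = ((a - n)%:R + c) * mxe M (a - n) b.
Proof.
move=> /andP[na aN]; rewrite mxe_mul.
have an : (a - n < N.+1)%N by lia.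
rewrite (bigD1 (Ordinal an)) //= mxe_Lmx ?subnK ?eqxx //.
rewrite big1 ?addr0 // => -[k kN]; rewrite -val_eqE /= => kan.
by rewrite mxe_Lmx // ifF ?mul0r //; lia.
Qed.

Lemma mxe_Lmx_mul0 n M a b : (a <= N)%N -> (a < n)%N ->
  mxe (Lmx n * M) a b = 0.
Proof.
move=> aN an; rewrite mxe_mul big1 // => -[k /= kN] _.
by rewrite mxe_Lmx // ifF ?mul0r //; lia.
Qed.

Lemma mxeP (M M' : 'M[R]_N.+1) :
  (forall a b, (a <= N)%N -> (b <= N)%N -> mxe M a b = mxe M' a b) -> M = M'.
Proof.
by move=> MM'; apply/matrixP => a b; have := MM' a b;
  rewrite /mxe !inord_val; apply; rewrite -ltnS.
Qed.

(** The powers beyond [x^(c+N)] span a submodule, so the truncation is a quotient module and keeps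
    the relations. *)
Lemma Lmx_relation : vect_relation Lmx.
Proof.
move=> n m n0 m0; apply: mxeP => a b aN bN.
have LL k l : mxe (Lmx k * Lmx l) a b =
    if a == (b + (k + l))%N then ((b + l)%:R + c) * (b%:R + c) else 0.
  have [ka|ak] := leqP k a; last by rewrite mxe_Lmx_mul0 // ifF //; lia.
  rewrite mxe_Lmx_mul ?ka // mxe_Lmx //; last lia.
  have [ab|ab] := eqVneq a (b + (k + l))%N; last by rewrite ifF ?mulr0 //; lia.
  by rewrite ifT; [congr (((_)%:R + _) * _); lia|lia].
rewrite mxeD -[- (_ * _)]scaleN1r !mxeZ !LL mxe_Lmx // (addnC n m).
case: ifP => _; last by ring.
by rewrite !natrD; ring.
Qed.

End DensityModule.

(** * Exponentials of vector fields as substitutions in power series *)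

Section OperatorExponential.
Variable R : realType.
Implicit Types p F gamma : nat -> R.

(** At [c = 0] the module is [R[[x]]] cut at degree [N]; only the component of degree [n - m]
    carries [x^m] to [x^n]. *)
Lemma iter_vect_act_mx N p F k n : p 0%N = 0 -> (n <= N)%N ->
  iter k (vect_act p) F n = \sum_(m < n.+1)
    mxe (series_pow (fun j => p j *: Lmx N 0 j) k (n - m)) n m * F m.
Proof.
move=> p0; elim: k n => [|k IHk] n nN.
  rewrite big_ord_recr /= subnn mxe1 // eqxx !mul1r big1 ?add0r // => -[m mn] _ /=.
  rewrite mxe1 //; last lia.
  by rewrite (_ : (n - m)%N == 0%N = false) ?mul0r //; lia.
rewrite iterS /vect_act.
pose f j m := p j * ((n - j)%:R *
  mxe (series_pow (fun j => p j *: Lmx N 0 j) k (n - m - j)) (n - j) m) * F m.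
transitivity (\sum_(j < n.+1) \sum_(m < n.+1 - j) f j m).
  rewrite big_ord_recl [X in X + _]big1 ?add0r; last first.
    by move=> m _; rewrite /f p0 !mul0r.
  rewrite big_add1 big_mkord; apply: eq_bigr => -[j /= jn] _.
  rewrite /bump add1n IHk ?(leq_trans (leq_subr _ _)) // !mulr_sumr subSn //.
  by apply: eq_bigr => -[m mn] _; rewrite /f /= subnAC !mulrA.
rewrite (sum_triangle_swap f); apply: eq_bigr => -[m /= mn] _.
rewrite mxe_sum mulr_suml subSn -1?ltnS //.
apply: eq_bigr => -[j /= jn] _; rewrite /f -scalerAl mxeZ mxe_Lmx_mul; last lia.
by rewrite addr0.
Qed.

Lemma exp_act_mx N p F n : p 0%N = 0 -> (n <= N)%N ->
  exp_act p F n =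
  \sum_(m < n.+1) mxe (fexp (Lmx N 0) p (n - m)) n m * F m.
Proof.
move=> p0 nN; rewrite /exp_act.
under eq_bigr do rewrite (iter_vect_act_mx _ _ p0 nN) mulr_sumr.
rewrite exchange_big; apply: eq_bigr => -[m /= mn] _.
rewrite (fexpE _ p0 (leq_trans (leq_subr m n) nN)) mxe_sum mulr_suml.
rewrite (big_ord_widen N.+1 (fun k => k`!%:R^-1 *
  (mxe (series_pow (fun j => p j *: Lmx N 0 j) k (n - m)) n m * F m))) //.
rewrite big_mkcond /=; apply: eq_bigr => k _.
rewrite mxeZ -mulrA (series_powE _ _ (leq_trans (leq_subr m n) nN)).
case: ifPn => //; rewrite -leqNgt => nk.
rewrite coef_exp_small; last lia.
  by rewrite mxe0 mul0r mulr0.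
by rewrite coef_poly /= p0 scale0r.
Qed.

Definition exp_monomial p k : nat -> R := exp_act p (fun i => (i == k)%:R).

Lemma exp_monomialE N p k n : p 0%N = 0 -> (k <= n <= N)%N ->
  exp_monomial p k n = mxe (fexp (Lmx N 0) p (n - k)) n k.
Proof.
move=> p0 /andP[kn nN]; rewrite /exp_monomial (exp_act_mx _ p0 nN).
have kn' : (k < n.+1)%N by [].
rewrite (bigD1 (Ordinal kn')) //= eqxx mulr1 big1 ?addr0 // => m.
by rewrite -val_eqE /= => /negPf ->; rewrite mulr0.
Qed.

Lemma exp_monomial_small p k n : p 0%N = 0 -> (n < k)%N ->
  exp_monomial p k n = 0.
Proof.
move=> p0 nk; rewrite /exp_monomial (exp_act_mx _ p0 (leqnn n)) big1 // => -[m /= mn] _.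
by rewrite (_ : m == k = false) ?mulr0 //; lia.
Qed.

Lemma exp_monomial_lead p k : p 0%N = 0 -> exp_monomial p k k = 1.
Proof.
move=> p0; rewrite (exp_monomialE p0 (N := k)) ?leqnn // subnn fexp0.
by rewrite (mxe1 _ 1) // eqxx mulr1.
Qed.

Lemma exp_act_monomials p F n : p 0%N = 0 ->
  exp_act p F n = \sum_(k < n.+1) F k * exp_monomial p k n.
Proof.
move=> p0; rewrite (exp_act_mx _ p0 (leqnn n)); apply: eq_bigr => -[k /= kn] _.
by rewrite (exp_monomialE p0 (N := n)) 1?mulrC // leqnn andbT -ltnS.
Qed.

Lemma exp_monomial_rec p k d : p 0%N = 0 ->
  d%:R * exp_monomial p k (k + d) = \sum_(j < d)
    exp_logderiv p (d - j) * ((k + j)%:R * exp_monomial p k (k + j)).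
Proof.
move=> p0; have kdN : (k <= k + d <= k + d)%N by rewrite leq_addr leqnn.
rewrite (exp_monomialE p0 kdN) addKn -mxeZ fexp_rec //; last exact: Lmx_relation.
rewrite mxe_sum; apply: eq_bigr => -[j /= jd] _.
rewrite mxeZ mxe_Lmx_mul; last lia.
rewrite (exp_monomialE p0 (N := (k + d)%N)); last lia.
by rewrite addKn addr0 (_ : k + d - (d - j) = k + j)%N //; lia.
Qed.

(** The hypothesis reads [x gamma' - gamma = q x gamma']; multiplication by [k gamma^(k-1)] turns it
    into the equation for [gamma^k]. *)
Lemma series_pow_rec gamma q k d : Diffbar gamma ->
  (forall n, n%:R * gamma n.+1 =
    \sum_(j < n) q (n - j)%N * (j.+1%:R * gamma j.+1)) ->
  d%:R * series_pow gamma k (k + d) = \sum_(j < d)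
    q (d - j)%N * ((k + j)%:R * series_pow gamma k (k + j)).
Proof.
move=> [g0 g1] gE; set N := (k + d)%N.
pose G := \poly_(i < N.+1) gamma i.
pose Q := \poly_(i < N.+1) (if i == 0%N then 0 else q i).
have coefXD (P : {poly R}) m : ('X * P^`())`_m = m%:R * P`_m.
  rewrite coefXM; case: m => [|m] /=; first by rewrite mul0r.
  by rewrite coef_deriv mulr_natl.
have coefQXD (P : {poly R}) m : (m <= N)%N ->
    (Q * ('X * P^`()))`_m = \sum_(j < m) q (m - j)%N * (j%:R * P`_j).
  move=> mN; rewrite coefMr big_ord_recr /= subnn coef_poly /= mul0r addr0.
  apply: eq_bigr => -[j /= jm] _; rewrite coefXD coef_poly.
  by rewrite ifT ?ifF //; lia.
have GE m : (m <= N)%N -> ('X * G^`() - G - Q * ('X * G^`()))`_m = 0.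
  move=> mN; rewrite !coefB coefXD coefQXD // coef_poly ltnS mN.
  case: m mN => [|m] mN; first by rewrite big_ord0 g0 mulr0 !subr0.
  rewrite -natr1 mulrDl mul1r addrK gE big_ord_recl !mul0r mulr0 add0r.
  apply/eqP; rewrite subr_eq0; apply/eqP; apply: eq_bigr => -[j /= jm] _.
  by rewrite /bump /= add1n subSS coef_poly ifT //; lia.
have GkE : ('X * (G ^+ k)^`() - G ^+ k *+ k - Q * ('X * (G ^+ k)^`()))`_N = 0.
  have -> : 'X * (G ^+ k)^`() - G ^+ k *+ k - Q * ('X * (G ^+ k)^`()) =
      (G ^+ k.-1 *+ k) * ('X * G^`() - G - Q * ('X * G^`())).
    rewrite deriv_exp; case: (k) => [|k'] /=; first by rewrite !mulr0n; ring.
    by rewrite exprSr; ring.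
  by rewrite coefM big1 // => -[i /= iN] _; rewrite GE ?mulr0 ?leq_subr.
have G0 : G`_0 = 0 by rewrite coef_poly /= g0.
move: GkE; rewrite !coefB coefXD coefMn coefQXD // -[_`_N *+ k]mulr_natl -mulrBl.
rewrite -natrB ?leq_addr // addKn => /eqP; rewrite subr_eq0 => /eqP.
rewrite (series_powE gamma k (leqnn N)) -/G => ->.
rewrite /N -(big_mkord xpredT (fun j => q (k + d - j)%N * (j%:R * (G ^+ k)`_j))).
rewrite (big_cat_nat (n := k)) ?leq_addr //=.
rewrite big_nat big1 ?add0r; last first.
  by move=> j /andP[_ jk]; rewrite coef_exp_small ?mulr0.
rewrite -{1}[k]add0n big_addn addKn big_mkord; apply: eq_bigr => -[j /= jd] _.
rewrite (series_powE gamma k (N := N)) ?leq_add2l ?(ltnW jd) //.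
by rewrite [(j + k)%N]addnC subnDl.
Qed.

Lemma series_pow_lead gamma k : Diffbar gamma -> series_pow gamma k k = 1.
Proof.
move=> [g0 g1]; elim: k => [//|k IHk].
rewrite -[LHS]/(\sum_(i < k.+2) gamma i * series_pow gamma k (k.+1 - i)).
rewrite 2!big_ord_recl /= g0 mul0r add0r /bump /= addn0 g1 mul1r subSS subn0 IHk.
rewrite big1 ?addr0 // => -[i /= ik] _.
rewrite !add1n subSS (series_powE gamma k (leqnn _)) coef_exp_small ?mulr0 //.
  by rewrite coef_poly /= g0.
lia.
Qed.

(** Both [gamma^k] and the image of [x^k] under [exp p] have coefficient 1 in degree [k] and obey
    the recursion driven by [exp_logderiv p], which the case [k = 1] supplies for [gamma]. *)
Lemma exp_monomial1_is_exp_of gamma p : Diffbar gamma -> p 0%N = 0 ->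
  (forall n, exp_monomial p 1 n = gamma n) -> is_exp_of gamma p.
Proof.
move=> gD p0 pg F; apply/funext => n; rewrite exp_act_monomials // /series_comp.
apply: eq_bigr => -[k /= kn] _; congr (_ * _).
rewrite -(subnKC (m := k) (n := n)) -1?ltnS //.
elim/ltn_ind: (n - k)%N => -[_|d IHd].
  by rewrite addn0 exp_monomial_lead // series_pow_lead.
apply: (@mulfI _ d.+1%:R); first by rewrite pnatr_eq0.
rewrite exp_monomial_rec // (@series_pow_rec gamma (exp_logderiv p)) //.
  by apply: eq_bigr => -[j /= jd] _; rewrite IHd.
by move=> m; rewrite -pg -add1n exp_monomial_rec //;
  apply: eq_bigr => j _; rewrite add1n -pg.
Qed.

(** [L_n] would reach degree [n] only from the constant term, which it kills. *)
Lemma iter_vect_act_local p p' F k n :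
  (forall i, (i < n)%N -> p i = p' i) ->
  iter k (vect_act p) F n = iter k (vect_act p') F n.
Proof.
elim: k n => // k IHk n pp'; rewrite !iterS /vect_act !big_nat.
apply: eq_bigr => j /andP[j0]; rewrite ltnS leq_eqVlt => /predU1P[->|jn].
  by rewrite subnn !mul0r !mulr0.
rewrite pp' // IHk // => i ijn; apply: pp'; lia.
Qed.

(** [p n] reaches the coefficient of [x^(n+1)] only through [L_n x = x^(n+1)]: in higher powers of
    the vector field the other factors already raise the degree. *)
Lemma exp_monomial1_split p n : p 0%N = 0 ->
  exp_monomial p 1 n.+1 =
  p n + exp_monomial (fun i => if (i < n)%N then p i else 0) 1 n.+1.
Proof.
move=> p0; case: n => [|n].
  rewrite p0 add0r !exp_monomial_lead //; by case: ifP.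
pose F i : R := (i == 1%N)%:R.
have E f : exp_monomial f 1 n.+2 = vect_act f F n.+2 + \sum_(k < n.+1)
    k.+2`!%:R^-1 * iter k.+2 (vect_act f) F n.+2.
  rewrite /exp_monomial /exp_act 2!big_ord_recl -/F.
  rewrite [iter ord0 _ _ _]/(0 : R) mulr0 add0r; congr (_ + _).
  by rewrite (_ : (lift ord0 ord0 : nat)`! = 1%N) // invr1 mul1r.
pose p' i := if (i < n.+1)%N then p i else 0.
rewrite !E {1 3}/vect_act.
have split1 (f : nat -> R) : \sum_(1 <= j < n.+3) f j * ((n.+2 - j)%:R *
    ((n.+2 - j)%N == 1%N)%:R) = f n.+1.
  rewrite big_nat_recr //= big_nat_recr //= subnn mul0r mulr0 addr0.
  rewrite subSS subSnn eqxx !mulr1 big_nat big1 ?add0r // => j /andP[j1 jn].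
  by rewrite (_ : (n.+2 - j)%N == 1%N = false) ?mulr0 //; lia.
rewrite !split1 ltnn add0r -/p'; congr (_ + _).
apply: eq_bigr => k _; congr (_ * _).
rewrite iterS [in RHS]iterS {1}/vect_act [in RHS]/vect_act.
rewrite !big_nat; apply: eq_bigr => j /andP[j1 jn].
have [jn'|] := ltnP j n.+1.
  rewrite {1}/p' jn' (@iter_vect_act_local p p') // => i ij.
  by rewrite /p' ifT //; lia.
(* For [j = n + 1] the remaining power is read in degree 1, where every [vect_act] vanishes because
   constants are killed. *)
rewrite leq_eqVlt => /predU1P[<-|nj]; last first.
  by rewrite (_ : (n.+2 - j)%N = 0%N) ?mul0r ?mulr0 //; lia.
rewrite subSnn !iterS /vect_act !big_nat1.
by rewrite subnn !mul0r !mulr0.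
Qed.

Lemma is_exp_of_exists gamma : Diffbar gamma ->
  exists2 p, p 0%N = 0 & is_exp_of gamma p.
Proof.
move=> gD; have [g0 g1] := gD.
(* [Phi] solves [exp_monomial1_split] for [p n]. *)
pose Phi (f : nat -> R) n := if n is 0 then 0 else gamma n.+1 -
  exp_monomial (fun i => if (i < n)%N then f i else 0) 1 n.+1.
have [f g n fg|p pE] := @nat_strong_rec R 0 Phi.
  rewrite /Phi; case: n fg => // n fg; congr (_ - exp_monomial _ _ _).
  by apply/funext => i; case: ifP => // /fg.
have p0 : p 0%N = 0 by rewrite pE.
exists p => //; apply: exp_monomial1_is_exp_of => // -[|[|n]].
- by rewrite exp_monomial_small.
- by rewrite exp_monomial_lead.
- by rewrite exp_monomial1_split // {1}pE /Phi subrK.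
Qed.

End OperatorExponential.

(** * Representations of U(vect) *)

Section Evaluation.
Variables (R : realType) (A : algType R) (X : nat -> A).
Hypothesis XP : vect_relation X.

(** The universal property, computed on a representative; [free_eval_vect_ideal] removes the
    dependence on the choice. *)
Definition Ueval (u : Uvect R) : A := free_eval (fun i => X i.+1) (repr u).

Lemma free_evalZ (I : choiceType) (B : algType R) (Y : I -> B) (x : R) w :
  free_eval Y (x *: w) = x *: free_eval Y w.
Proof.
have -> : x *: w = (mkmalgU mone x : free_alg R I) * w by rewrite mul_malgC.
rewrite rmorphM /= free_evalE mmapU /= mulr_algl.
by rewrite /word_eval fm1 big_nil -scalerAl mul1r.
Qed.

Lemma free_eval_freeL n : (0 < n)%N ->
  free_eval (fun i => X i.+1) (freeL R n) = X n.
Proof. by case: n => // n _; rewrite free_eval_letter. Qed.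

Lemma free_eval_vect_ideal x : vect_ideal x ->
  free_eval (fun i => X i.+1) x = 0.
Proof.
set f := free_eval _.
have f_rel (B : lalgType R) (g : {rmorphism B -> A}) a b c (k : R) :
    (forall x, g (k *: x) = k *: g x) ->
    g (a * b - b * a - k *: c) = g a * g b - g b * g a - k *: g c.
  by move=> gZ; rewrite !raddfB /= gZ !rmorphM.
have fM y z : f (y * z) = f y * f z by exact: rmorphM.
have fL k : (0 < k)%N -> f (freeL R k) = X k by exact: free_eval_freeL.
elim=> [n m n0 m0||{}x y _ x0 _ y0|a {}x b _ x0].
- apply: (etrans (f_rel (free_alg R nat) f _ _ _ _ (fun y => free_evalZ _ _ y))).
  by rewrite /= -!/f (fL n) // (fL m) // (fL (m + n)%N) ?addn_gt0 ?m0 // XP // subrr.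
- by rewrite /f raddf0.
- by rewrite /f raddfD /= -/f x0 y0 addr0.
- by rewrite !fM x0 mulr0 mul0r.
Qed.

Lemma Ueval_Upi x : Ueval (Upi x) = free_eval (fun i => X i.+1) x.
Proof.
have := free_eval_vect_ideal (reprP x); rewrite raddfB => /eqP.
by rewrite subr_eq0 => /eqP.
Qed.

Lemma UevalB : zmod_morphism Ueval.
Proof.
elim/Uind=> x; elim/Uind=> y.
by rewrite -raddfB !Ueval_Upi raddfB.
Qed.

Lemma UevalM : monoid_morphism Ueval.
Proof.
split=> [|]; first by rewrite -[1]/(Upi 1) Ueval_Upi rmorph1.
elim/Uind=> x; elim/Uind=> y.
by rewrite -rmorphM !Ueval_Upi rmorphM.
Qed.

Lemma UevalZ : scalable Ueval.
Proof.
by move=> c; elim/Uind=> x; rewrite -linearZ /= !Ueval_Upi free_evalZ.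
Qed.

HB.instance Definition _ := GRing.isZmodMorphism.Build (Uvect R) A Ueval UevalB.
HB.instance Definition _ := GRing.isMonoidMorphism.Build (Uvect R) A Ueval UevalM.

Lemma Ueval_UL n : (0 < n)%N -> Ueval (UL R n) = X n.
Proof. by move=> n0; rewrite Ueval_Upi free_eval_freeL. Qed.

Lemma Ueval_exp_U p n : p 0%N = 0 -> Ueval (exp_U p n) = fexp X p n.
Proof.
move=> p0; rewrite /exp_U /fexp raddf_sum /=; apply: eq_bigr => k _.
rewrite UevalZ; congr (_ *: _).
move: (k : nat) => {k} k; elim: k n => [|k IHk] n; first by rewrite rmorph_nat.
rewrite /series_pow !iterS /cauchy raddf_sum /=; apply: eq_bigr => i _.
rewrite rmorphM /= IHk UevalZ; congr (_ * _).
by case: {i}(i : nat) => [|i]; rewrite ?p0 ?scale0r // Ueval_UL.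
Qed.

Lemma Ueval_A2_pi w : Ueval (A2_pi w) =
  \sum_(m <- msupp w) mcoeff m w *: \prod_(i <- fmonom_val m) X i.+1.
Proof.
rewrite /A2_pi /free_eval raddf_sum /=; apply: eq_bigr => m _.
rewrite UevalZ rmorph_prod /=; congr (_ *: _).
by apply: eq_bigr => i _; rewrite Ueval_UL.
Qed.

End Evaluation.

(** * The norm [Q1] and its bound on [L_n] *)

Section A2Norm.
Variable R : realType.
Implicit Types (w : free_alg R 'I_2) (u v : Uvect R).

Lemma A2_norm_ge0 w : 0 <= A2_norm w.
Proof. exact: sumr_ge0. Qed.

Lemma A2_normEw (d : {fset fmonom 'I_2}) w : (msupp w `<=` d)%fset ->
  A2_norm w = \sum_(m <- d) `|mcoeff m w|.
Proof.
move=> wd; rewrite /A2_norm (big_fset_incl _ wd) // => m _ mw.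
by rewrite mcoeff_outdom // normr0.
Qed.

Lemma A2_normD w w' : A2_norm (w + w') <= A2_norm w + A2_norm w'.
Proof.
rewrite (A2_normEw (msuppD_le w w')) (A2_normEw (fsubsetUl _ (msupp w'))).
rewrite (A2_normEw (fsubsetUr (msupp w) _)) -big_split /=.
by apply: ler_sum => m _; rewrite mcoeffD ler_normD.
Qed.

Lemma A2_normZ c w : A2_norm (c *: w) = `|c| * A2_norm w.
Proof.
rewrite (A2_normEw (msuppZ_le c w)) mulr_sumr; apply: eq_bigr => m _.
by rewrite mcoeffZ normrM.
Qed.

Lemma A2_normU m c : A2_norm (mkmalgU m c : free_alg R 'I_2) = `|c|.
Proof. by rewrite (A2_normEw msuppU_le) big_seq_fset1 mcoeffUU. Qed.

Lemma A2_norm_sum I (r : seq I) (F : I -> free_alg R 'I_2) :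
  A2_norm (\sum_(i <- r) F i) <= \sum_(i <- r) A2_norm (F i).
Proof.
elim: r => [|i r IHr]; first by rewrite !big_nil /A2_norm msupp0 big_seq_fset0.
by rewrite !big_cons (le_trans (A2_normD _ _)) // lerD2l.
Qed.

Lemma A2_normM w w' : A2_norm (w * w') <= A2_norm w * A2_norm w'.
Proof.
rewrite [X in A2_norm X](malgME w w') (le_trans (A2_norm_sum _ _)) //.
rewrite mulr_suml; apply: ler_sum => m _.
rewrite (le_trans (A2_norm_sum _ _)) // mulr_sumr; apply: ler_sum => m' _.
by rewrite A2_normU normrM.
Qed.

HB.instance Definition _ := GRing.RMorphism.copy (@A2_pi R)
  (free_eval (fun i : 'I_2 => UL R i.+1)).

Lemma A2_piZ c w : A2_pi (c *: w) = c *: A2_pi w.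
Proof. exact: free_evalZ. Qed.

Definition A2_range u := exists w, A2_pi w = u.

Lemma A2_rangeD u v : A2_range u -> A2_range v -> A2_range (u + v).
Proof. by move=> [w <-] [w' <-]; exists (w + w'); rewrite raddfD. Qed.

Lemma A2_rangeZ c u : A2_range u -> A2_range (c *: u).
Proof. by move=> [w <-]; exists (c *: w); rewrite A2_piZ. Qed.

Lemma A2_rangeM u v : A2_range u -> A2_range v -> A2_range (u * v).
Proof. by move=> [w <-] [w' <-]; exists (w * w'); rewrite rmorphM. Qed.

Lemma A2_pi_letter (i : 'I_2) : A2_pi (letter R i) = UL R i.+1.
Proof. exact: free_eval_letter. Qed.

Lemma UL_step m : UL R m.+3 = m.+1%:R^-1 *:
  (UL R 1 * UL R m.+2 - UL R m.+2 * UL R 1).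
Proof.
rewrite UL_comm // scalerA -natrB // subSS subn0 mulVf ?scale1r ?addn1 //.
Qed.

Lemma A2_range_UL n : A2_range (UL R n.+1).
Proof.
case: n => [|n]; first by exists (letter R (ord0 : 'I_2)); rewrite A2_pi_letter.
elim: n => [|n IHn].
  by exists (letter R (ord_max : 'I_2)); rewrite A2_pi_letter.
have L1 : A2_range (UL R 1).
  by exists (letter R (ord0 : 'I_2)); rewrite A2_pi_letter.
rewrite UL_step -scaleN1r; apply: A2_rangeZ; apply: A2_rangeD.
  exact: A2_rangeM.
by apply: A2_rangeZ; apply: A2_rangeM.
Qed.

(** [L_1] and [L_2] generate by [UL_step]. Hence the infimum in [Q1] is over a nonempty set and is
    not the default value of [inf]. *)
Lemma A2_pi_surj u : A2_range u.
Proof.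
elim/Uind: u => x; have -> : x = \sum_(m <- msupp x)
    mcoeff m x *: (mkmalgU m 1 : free_alg R nat).
  rewrite [LHS](monalgE x); apply: eq_bigr => m _.
  rewrite -[RHS](mul_malgC _ (mkmalgU m 1)) [RHS]fgmulUU.
  by rewrite mul1m mulr1.
rewrite raddf_sum /=; apply: (big_ind A2_range) => [||m _].
- by exists 0; rewrite raddf0.
- exact: A2_rangeD.
rewrite linearZ; apply: A2_rangeZ; case: m; elim=> [|i s IHs].
  exists 1; rewrite rmorph1; congr Upi; rewrite -[LHS]/(mkmalgU mone 1).
  by congr mkmalgU; apply/eqP; rewrite fmP fm1.
have -> : mkmalgU (FMonom (i :: s)) 1 =
    freeL R i.+1 * (mkmalgU (FMonom s) 1 : free_alg R nat).
  rewrite [RHS]fgmulUU mulr1; congr mkmalgU; apply/eqP.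
  by rewrite fmP fmM /fmu fmE.
by rewrite rmorphM; apply: A2_rangeM => //; exact: A2_range_UL.
Qed.

Lemma Q1_has_inf u : has_inf [set A2_norm w | w in [set w | A2_pi w = u]].
Proof.
split; first by have [w wu] := A2_pi_surj u; exists (A2_norm w), w.
by exists 0 => _ [w _ <-]; exact: A2_norm_ge0.
Qed.

Lemma Q1_le w : Q1 (A2_pi w) <= A2_norm w.
Proof. by apply: ge_inf; [have [] := Q1_has_inf (A2_pi w)|exists w]. Qed.

Lemma Q1_lb (x : R) u : (forall w, A2_pi w = u -> x <= A2_norm w) -> x <= Q1 u.
Proof.
move=> xu; apply: lb_le_inf; first by have [] := Q1_has_inf u.
by move=> _ [w wu <-]; exact: xu.
Qed.

Lemma Q1_ge0 u : 0 <= Q1 u.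
Proof. by apply: Q1_lb => w _; exact: A2_norm_ge0. Qed.

Lemma Q1Z_le c u : Q1 (c *: u) <= `|c| * Q1 u.
Proof.
have [->|c0] := eqVneq c 0.
  rewrite scale0r normr0 mul0r -(raddf0 (@A2_pi R)) (le_trans (Q1_le _)) //.
  by rewrite /A2_norm msupp0 big_seq_fset0.
rewrite -ler_pdivrMl ?normr_gt0 //; apply: Q1_lb => w wu.
by rewrite ler_pdivrMl ?normr_gt0 // -A2_normZ -wu -A2_piZ; exact: Q1_le.
Qed.

Lemma Q1D_le u v : Q1 (u + v) <= Q1 u + Q1 v.
Proof.
rewrite -lerBlDr; apply: Q1_lb => w wu.
rewrite lerBlDr -lerBlDl; apply: Q1_lb => w' wv.
by rewrite lerBlDl -wu -wv -raddfD (le_trans (Q1_le _)) // A2_normD.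
Qed.

Lemma Q1B_le u v : Q1 (u - v) <= Q1 u + Q1 v.
Proof.
rewrite -scaleN1r (le_trans (Q1D_le _ _)) // lerD2l.
by rewrite (le_trans (Q1Z_le _ _)) // normrN1 mul1r.
Qed.

Lemma Q1M_le u v : Q1 (u * v) <= Q1 u * Q1 v.
Proof.
have [w0 wv0] := A2_pi_surj v.
have Q1Ml w : Q1 (A2_pi w * v) <= A2_norm w * Q1 v.
  (* One factor is divided out to take the infimum over the other, so norm 0 is a separate case. *)
  have [w_0|w_gt0] := eqVneq (A2_norm w) 0.
    rewrite w_0 mul0r -wv0 -rmorphM (le_trans (Q1_le _)) //.
    by rewrite (le_trans (A2_normM _ _)) // w_0 mul0r.
  have {}w_gt0 : 0 < A2_norm w by rewrite lt_def w_gt0 A2_norm_ge0.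
  rewrite -ler_pdivrMl //; apply: Q1_lb => w' <-.
  by rewrite ler_pdivrMl // -rmorphM (le_trans (Q1_le _)) // A2_normM.
have [v_0|v_gt0] := eqVneq (Q1 v) 0.
  by have [w <-] := A2_pi_surj u; rewrite (le_trans (Q1Ml w)) // v_0 !mulr0.
have {}v_gt0 : 0 < Q1 v by rewrite lt_def v_gt0 Q1_ge0.
by rewrite -ler_pdivrMr //; apply: Q1_lb => w <-; rewrite ler_pdivrMr.
Qed.

Lemma Q1_sum_le n (F : nat -> Uvect R) :
  Q1 (\sum_(i < n) F i) <= \sum_(i < n) Q1 (F i).
Proof.
elim: n => [|n IHn]; last first.
  by rewrite !big_ord_recr (le_trans (Q1D_le _ _)) // lerD2r.
by rewrite !big_ord0 -(scale0r 0) (le_trans (Q1Z_le _ _)) // normr0 mul0r.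
Qed.

Lemma Q1_UL1 : Q1 (UL R 1) <= 1.
Proof.
rewrite -(A2_pi_letter ord0) (le_trans (Q1_le _)) //.
by rewrite A2_normU normr1.
Qed.

(** Both products in [UL_step] have norm at most that of [L_(m+2)], so each step costs a factor
    [2 / (m+1)]. *)
Lemma Q1_UL m : Q1 (UL R m.+2) <= 2 ^+ m / m`!%:R.
Proof.
elim: m => [|m IHm].
  rewrite -(A2_pi_letter ord_max) (le_trans (Q1_le _)) //.
  by rewrite A2_normU normr1 divr1.
have L1m : Q1 (UL R 1 * UL R m.+2) <= 2 ^+ m / m`!%:R.
  rewrite (le_trans (Q1M_le _ _)) // -[leRHS]mul1r.
  by rewrite ler_pM ?Q1_ge0 // Q1_UL1.
have Lm1 : Q1 (UL R m.+2 * UL R 1) <= 2 ^+ m / m`!%:R.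
  rewrite (le_trans (Q1M_le _ _)) // -[leRHS]mulr1.
  by rewrite ler_pM ?Q1_ge0 // Q1_UL1.
rewrite UL_step (le_trans (Q1Z_le _ _)) // ger0_norm ?invr_ge0 //.
apply: (@le_trans _ _ (m.+1%:R^-1 * (2 * (2 ^+ m / m`!%:R)))); last first.
  by rewrite factS natrM invfM exprS le_eqVlt; apply/orP; left; apply/eqP; ring.
rewrite ler_wpM2l ?invr_ge0 //; apply: le_trans (Q1B_le _ _) _.
have mul2 (y : R) : 2 * y = y + y by ring.
by rewrite mul2; exact: lerD L1m Lm1.
Qed.

(** Linearity over the words of a preimage, then the infimum over preimages. Matrix entries thus
    bound [Q1] from below. *)
Lemma mxe_Ueval_le N (X : nat -> 'M[R]_N.+1) a b C u : vect_relation X ->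
  (forall s : seq 'I_2, `|mxe (\prod_(i <- s) X i.+1) a b| <= C) ->
  `|mxe (Ueval X u) a b| <= Q1 u * C.
Proof.
move=> XP XC; have C0 : 0 <= C by apply: le_trans (XC [::]).
have w_le w : `|mxe (Ueval X (A2_pi w)) a b| <= A2_norm w * C.
  rewrite Ueval_A2_pi // mxe_sum mulr_suml (le_trans (ler_norm_sum _ _ _)) //.
  by apply: ler_sum => m _; rewrite mxeZ normrM ler_wpM2l.
have [C_0|C_gt0] := eqVneq C 0.
  by have [w <-] := A2_pi_surj u; rewrite (le_trans (w_le w)) // C_0 !mulr0.
have {}C_gt0 : 0 < C by rewrite lt_def C_gt0.
by rewrite -ler_pdivrMr //; apply: Q1_lb => w <-; rewrite ler_pdivrMr.
Qed.

End A2Norm.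

(** * Homogeneity of the components of the exponential *)

Section Grading.
Variable R : realType.
Implicit Types u v : Uvect R.

Lemma Udeg0 n : Udeg n (0 : Uvect R).
Proof. by exists 0; rewrite ?raddf0 // => w; rewrite msupp0 inE. Qed.

Lemma Udeg_sum n m (F : nat -> Uvect R) :
  (forall i, (i < m)%N -> Udeg n (F i)) -> Udeg n (\sum_(i < m) F i).
Proof.
elim: m => [_|m IHm Fn].
  by rewrite big_ord0; exact: Udeg0.
have [|x xn xE] := IHm; first by move=> i im; apply: Fn; exact: ltnW.
have [y yn yE] := Fn m (ltnSn m).
rewrite big_ord_recr /= -xE -yE -raddfD; exists (x + y) => // w.
by move=> /(fsubsetP (msuppD_le x y)); rewrite inE => /orP[/xn|/yn].
Qed.

Lemma UdegZ n c u : Udeg n u -> Udeg n (c *: u).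
Proof.
move=> [x xn <-]; rewrite -linearZ; exists (c *: x) => // w.
by move=> /(fsubsetP (msuppZ_le c x)) /xn.
Qed.

Lemma UdegM n m u v : Udeg n u -> Udeg m v -> Udeg (n + m) (u * v).
Proof.
move=> [x xn <-] [y ym <-]; rewrite -rmorphM; exists (x * y) => // w.
move=> /msuppM_le[w1 [w2 [/xn w1n /ym w2m ->]]].
by rewrite -w1n -w2m /word_weight fmM big_cat.
Qed.

Lemma Udeg1 : Udeg 0 (1 : Uvect R).
Proof.
exists 1; rewrite ?rmorph1 // => w; rewrite msuppU1 inE => /eqP ->.
by rewrite /word_weight fm1 big_nil.
Qed.

Lemma Udeg_UL n : Udeg n.+1 (UL R n.+1).
Proof.
exists (freeL R n.+1) => // w; rewrite msuppU1 inE => /eqP ->.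
by rewrite /word_weight /fmu fmE /= big_seq1.
Qed.

Lemma Ubar_exp_U p : p 0%N = 0 -> Ubar (exp_U p : nat -> Uvect R).
Proof.
move=> p0 n; pose f k : Uvect R := series_pow (fun j => p j *: UL R j) k n.
apply: (@Udeg_sum n n.+1 (fun k => k`!%:R^-1 *: f k)) => k _; apply: UdegZ.
rewrite /f {f}.
elim: k n => [|k IHk] n.
  case: n => [|n]; first exact: Udeg1.
  exact: Udeg0.
pose f i : Uvect R :=
  (p i *: UL R i) * series_pow (fun j : nat => p j *: UL R j) k (n - i)%N.
apply: (@Udeg_sum n n.+1 f) => i ilt; rewrite /f {f}.
case: i ilt => [|i] ilt; last first.
  by rewrite -{1}(subnKC (m := i.+1) (n := n)) //; apply: UdegM (IHk _);
    apply: UdegZ; exact: Udeg_UL.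
by rewrite p0 scale0r mul0r; exact: Udeg0.
Qed.

End Grading.

(** * Inverse binomial estimates *)

Lemma mul_lt_bin d e : (d * e < 'C(d + e, d))%N.
Proof.
elim: d e => [|d IHd] e; first by rewrite mul0n bin0.
elim: e => [|e IHe]; first by rewrite muln0 addn0 binn.
rewrite addSn binS; have := IHd e.+1; have := IHe; rewrite addSnnS; nia.
Qed.

(** [(d+1) e <= 2 d e], and [C(d+e, d)] exceeds [d e]. This absorbs the factor [d + 1] of
    [exp_logderiv_le] and the factor [e] in [L_d x^e = e x^(d+e)]. *)
Lemma fact_mul_le d e : (0 < d)%N ->
  ((d.+1 * e) * (d`! * e`!) <= 2 * (d + e)`!)%N.
Proof.
move=> d0; have := mul_lt_bin d e; have := bin_fact (leq_addr e d).
rewrite addKn => <-; move: ('C(_, _)) (d`! * e`!)%N => C f; nia.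
Qed.

(** Here [C(d+e, d) >= d e + 1 >= d + e]; the gain is the factor [1 / n] of
    [bounded_sums_gronwall]. *)
Lemma fact_mul_addn_le d e : (0 < d)%N -> (0 < e)%N ->
  ((d + e) * (d`! * e`!) <= (d + e)`!)%N.
Proof.
move=> d0 e0; have := mul_lt_bin d e; have := bin_fact (leq_addr e d).
rewrite addKn => <-; move: ('C(_, _)) (d`! * e`!)%N => C f deC.
rewrite leq_mul2r; apply/orP; right; nia.
Qed.

(** * Matrix entries of exp p and of its inverse *)

Section MatrixCoefficients.
Variables (R : realType) (N : nat) (c : R).

Lemma series_powSr (B : nzRingType) (a : nat -> B) k n :
  series_pow a k.+1 n = \sum_(i < n.+1) series_pow a k (n - i) * a i.
Proof.
rewrite (series_powE a _ (leqnn n)) exprSr coefMr; apply: eq_bigr => -[i /= ilt] _.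
rewrite coef_poly ltnS -ltnS ilt (series_powE a _ (N := n)) //; lia.
Qed.

Lemma mxe_tr (M : 'M[R]_N.+1) a b : mxe M^T a b = mxe M b a.
Proof. by rewrite /mxe mxE. Qed.

Lemma trmx_mulr (M M' : 'M[R]_N.+1) : (M * M')^T = M'^T * M^T.
Proof. exact: trmx_mul. Qed.

Definition Lmx_dual (n : nat) : 'M[R]_N.+1 := - (Lmx N c n)^T.

Lemma Lmx_dual_relation : vect_relation Lmx_dual.
Proof.
move=> n m n0 m0; rewrite /Lmx_dual !mulrNN -!trmx_mulr -raddfB /=.
by rewrite -opprB (Lmx_relation _ _ n0 m0) linearN /= linearZ scalerN.
Qed.

(** Transposition reverses products and the sign of [p] moves to the operators. Entries of the
    inverse are thereby bounded by [Q1] of [exp p] itself. *)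
Lemma tr_fexp_opp p n :
  (fexp (Lmx N c) (fun j => - p j) n)^T = fexp Lmx_dual p n.
Proof.
rewrite /fexp raddf_sum /=; apply: eq_bigr => k _; rewrite linearZ /=.
congr (_ *: _); move: (k : nat) => {k} k; elim: k n => [|k IHk] n.
  by rewrite /series_pow /= -scaler_nat linearZ /= trmx1 scaler_nat.
rewrite series_powSr raddf_sum /=; apply: eq_bigr => i _.
rewrite trmx_mulr IHk linearZ /= /Lmx_dual scaleNr scalerN //.
Qed.

(** The transposed recursion of the dual module: [D v = - v l] with the same [l] as for [exp p]. *)
Lemma fexp_opp_rec p n : p 0%N = 0 ->
  n%:R *: fexp (Lmx N c) (fun j => - p j) n =
  - \sum_(j < n) fexp (Lmx N c) (fun j => - p j) j *
      (exp_logderiv p (n - j) *: Lmx N c (n - j)).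
Proof.
move=> p0; apply: trmx_inj; rewrite linearZ /= tr_fexp_opp.
rewrite (fexp_rec Lmx_dual_relation) // raddfN raddf_sum /= -sumrN.
apply: eq_bigr => j _; rewrite trmx_mulr tr_fexp_opp linearZ /=.
by rewrite /Lmx_dual mulNr scalerN -scalerAl.
Qed.

Lemma logderiv_exp_mx p n : p 0%N = 0 -> (0 < n)%N ->
  \sum_(i < n.+1) i%:R *: (fexp (Lmx N c) p i *
    fexp (Lmx N c) (fun j => - p j) (n - i)) =
  exp_logderiv p n *: Lmx N c n.
Proof.
move=> p0; apply: (logderiv_mul_inv (l := fun n => exp_logderiv p n *: Lmx N c n)).
- exact: fexp0.
- exact: fexp0.
- move=> m; rewrite (fexp_rec (@Lmx_relation _ _ _)) //.
  by apply: eq_bigr => j _; rewrite scalerAl.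
- by move=> m; exact: fexp_opp_rec.
Qed.

(** A word carries [x^(c+b)] to [x^(c+a)] with a coefficient at most the quotient of the weights;
    the maximum with 1 covers the index that [L_2] skips. *)
Definition Lmx_weight (a : nat) : R := \prod_(i < a) Num.max 1 `|i%:R + c|.

Lemma Lmx_weight_gt0 a : 0 < Lmx_weight a.
Proof. by apply: prodr_gt0 => i _; rewrite lt_max ltr01. Qed.

(** With a single nonzero diagonal, a product entry has one term at most, the quotients telescope,
    and no factor counting indices appears. *)
Definition graded_le (m : nat) (M : 'M[R]_N.+1) := forall a b,
  (a <= N)%N -> (b <= N)%N -> `|mxe M a b| <=
  if a == (b + m)%N then Lmx_weight a / Lmx_weight b else 0.

Lemma graded_leM m m' M M' : graded_le m M -> graded_le m' M' ->
  graded_le (m + m') (M * M').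
Proof.
move=> Mm Mm' a b aN bN; rewrite mxe_mul.
apply: le_trans (ler_norm_sum _ _ _) _.
have le k : (k <= N)%N -> `|mxe M a k * mxe M' k b| <=
    (if a == (k + m)%N then Lmx_weight a / Lmx_weight k else 0) *
    (if k == (b + m')%N then Lmx_weight k / Lmx_weight b else 0).
  by move=> kN; rewrite normrM ler_pM // ?Mm ?Mm'.
(* The only possible intermediate index is [b + m']; beyond [N] the product vanishes. *)
have [bm'N|Nbm'] := leqP (b + m')%N N; last first.
  rewrite big1 => [|[k kN] _ /=]; first by case: ifP => // _;
    rewrite divr_ge0 // ltW ?Lmx_weight_gt0.
  apply/eqP; rewrite eq_le normr_ge0 andbT (le_trans (le k _)) //.
  by rewrite [X in _ * X]ifF ?mulr0 //; lia.
have bm'N1 : (b + m' < N.+1)%N by [].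
rewrite (bigD1 (Ordinal bm'N1)) //= big1 ?addr0 => [|[k kN]]; last first.
  rewrite -val_eqE /= => kb; apply/eqP.
  rewrite eq_le normr_ge0 andbT (le_trans (le k _)) //.
  by rewrite [X in _ * X]ifF ?mulr0 //; lia.
apply: le_trans (le _ bm'N) _; rewrite eqxx.
rewrite (_ : a == b + m' + m = (a == b + (m + m')))%N; last lia.
case: ifP => _; last by rewrite mul0r.
by rewrite mulrA divfK // gt_eqF ?Lmx_weight_gt0.
Qed.

Lemma graded_le1 : graded_le 0 1.
Proof.
move=> a b aN bN; rewrite (mxe1 _ 1) // mul1r addn0.
case: eqP => [->|_]; last by rewrite normr0.
by rewrite normr1 divff // gt_eqF ?Lmx_weight_gt0.
Qed.

Lemma graded_le_Lmx (i : 'I_2) : graded_le i.+1 (Lmx N c i.+1).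
Proof.
move=> a b aN bN; rewrite mxe_Lmx //.
case: ifP => [/eqP ->|_]; last by rewrite normr0.
have le1 k : 1 <= Num.max 1 `|k%:R + c| by rewrite le_max lexx.
have lec : `|b%:R + c| <= Num.max 1 `|b%:R + c| by rewrite le_max lexx orbT.
rewrite ler_pdivlMr ?Lmx_weight_gt0 // mulrC /Lmx_weight.
case: i => [[|[|//]]] /= _; rewrite ?addn1 ?addn2 !big_ord_recr /= -?mulrA;
  rewrite ler_wpM2l ?(ltW (Lmx_weight_gt0 _)) //.
by rewrite -[leLHS]mulr1 ler_pM.
Qed.

Lemma graded_leN m M : graded_le m M -> graded_le m (- M).
Proof.
by move=> Mm a b aN bN; rewrite -scaleN1r mxeZ normrM normrN1 mul1r; exact: Mm.
Qed.

Lemma graded_le_bound m M a b : graded_le m M -> (a <= N)%N -> (b <= N)%N ->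
  `|mxe M a b| <= Lmx_weight a / Lmx_weight b.
Proof.
move=> Mm aN bN; apply: le_trans (Mm a b aN bN) _; case: ifP => // _.
by rewrite divr_ge0 // ltW ?Lmx_weight_gt0.
Qed.

Lemma graded_le_word (s : seq 'I_2) :
  exists m, graded_le m (\prod_(i <- s) Lmx N c i.+1).
Proof.
elim: s => [|i s [m IHs]]; first by exists 0%N; rewrite big_nil; exact: graded_le1.
by exists (i.+1 + m)%N; rewrite big_cons; apply: graded_leM => //; exact: graded_le_Lmx.
Qed.

Lemma graded_le_word_dual (s : seq 'I_2) :
  exists m, graded_le m (\prod_(i <- s) Lmx_dual i.+1)^T.
Proof.
elim: s => [|i s [m IHs]].
  by exists 0%N; rewrite big_nil trmx1; exact: graded_le1.
exists (m + i.+1)%N; rewrite big_cons trmx_mulr; apply: graded_leM => //.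
rewrite /Lmx_dual linearN /= trmxK; apply: graded_leN; exact: graded_le_Lmx.
Qed.

Lemma mxe_exp_le p n a b : p 0%N = 0 -> (a <= N)%N -> (b <= N)%N ->
  `|mxe (fexp (Lmx N c) p n) a b| <=
  Q1 (exp_U p n) * (Lmx_weight a / Lmx_weight b).
Proof.
move=> p0 aN bN; rewrite -(Ueval_exp_U (@Lmx_relation _ _ _)) //.
apply: mxe_Ueval_le; first exact: Lmx_relation.
by move=> s; have [m /graded_le_bound] := graded_le_word s; apply.
Qed.

Lemma mxe_exp_opp_le p n a b : p 0%N = 0 -> (a <= N)%N -> (b <= N)%N ->
  `|mxe (fexp (Lmx N c) (fun j => - p j) n) a b| <=
  Q1 (exp_U p n) * (Lmx_weight a / Lmx_weight b).
Proof.
move=> p0 aN bN; rewrite -mxe_tr tr_fexp_opp -(Ueval_exp_U Lmx_dual_relation) //.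
apply: mxe_Ueval_le; first exact: Lmx_dual_relation.
by move=> s; rewrite -mxe_tr; have [m /graded_le_bound] := graded_le_word_dual s; apply.
Qed.

End MatrixCoefficients.

(** * The logarithmic derivative bounded by the exponential *)

Section LogderivBound.
Variable R : realType.

(* At c = - n / 2 the product of the |i + c|, i < n, is about n! / 2^n: this  *)
(* symmetric choice of the weight is where the radius 2 t comes from.         *)
Lemma Lmx_weight_half n : (0 < n)%N ->
  Lmx_weight (- (n%:R / 2) : R) n <= 2 * (n`!%:R / 2 ^+ n).
Proof.
elim/ltn_ind: n => -[//|[_ _|[_ _|n IHn _]]].
- rewrite /Lmx_weight big_ord1 add0r normrN ger0_norm // max_l; last lra.
  by rewrite (_ : 1`! = 1%N) // expr1; lra.
- rewrite /Lmx_weight !big_ord_recl big_ord0 /bump /= !mulr1.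
  rewrite add0r normrN divff ?pnatr_eq0 // normr1 maxxx subrr normr0.
  rewrite max_l ?ler01 // mulr1 (_ : 2`! = 2%N) // expr2; lra.
have /IHn/(_ isT) : (n.+1 < n.+3)%N by lia.
rewrite {1}/Lmx_weight; set P := \prod_(i < _) _ => Ple.
rewrite /Lmx_weight big_ord_recl big_ord_recr /=; set P' := \prod_(i < _) _.
have <- : P = P'.
  apply: eq_bigr => i _; rewrite /bump /= add1n; congr (Num.max _ `|_|).
  by rewrite -[i.+1%:R]natr1 -[n.+3%:R]natr1 -[n.+2%:R]natr1; field.
rewrite add0r normrN ger0_norm ?divr_ge0 // max_r; last first.
  by rewrite ler_pdivlMr // mul1r ler_nat.
have nE : `|(bump 0 n.+1)%:R - n.+3%:R / 2| = n.+1%:R / 2 :> R.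
  rewrite /bump /= add1n -[n.+3%:R]natr1 -[n.+2%:R]natr1.
  rewrite (_ : _ - _ = n.+1%:R / 2); last by field.
  by rewrite ger0_norm // divr_ge0.
have max_le : Num.max 1 (n.+1%:R / 2) <= n.+2%:R / 2 :> R.
  by rewrite ge_max ler_pdivlMr // mul1r ler_pM2r ?invr_gt0 // !ler_nat leqnSn.
rewrite nE.
apply: (@le_trans _ _ (n.+3%:R / 2 *
    (2 * (n.+1`!%:R / 2 ^+ n.+1) * (n.+2%:R / 2)))).
  rewrite ler_wpM2l ?divr_ge0 // ler_pM //.
  by apply: prodr_ge0 => i _; rewrite le_max ler01.
rewrite (factS n.+2) (factS n.+1) !natrM [2 ^+ n.+3]exprS [2 ^+ n.+2]exprS.
rewrite le_eqVlt; apply/orP; left; apply/eqP; field.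
by rewrite expf_neq0 // pnatr_eq0.
Qed.

(** Entry [(n, 0)] of [logderiv_exp_mx] with [N = n] and [c = - n / 2], where [L_n] contributes [c],
    of modulus [n / 2]. *)
Lemma exp_logderiv_le p n : p 0%N = 0 -> (0 < n)%N ->
  `|exp_logderiv p n| <= 4 * n.+1%:R * (n`!%:R / 2 ^+ n) *
    \sum_(i < n.+1) Q1 (exp_U p i : Uvect R) * Q1 (exp_U p (n - i)).
Proof.
move=> p0 n0; set S := \sum_(i < n.+1) _.
pose c : R := - (n%:R / 2); pose w := Lmx_weight c n.
have S0 : 0 <= S by apply: sumr_ge0 => i _; rewrite mulr_ge0 ?Q1_ge0.
have wn : w <= 2 * (n`!%:R / 2 ^+ n) by exact: Lmx_weight_half.
have := congr1 (fun M => `|mxe M n 0|) (logderiv_exp_mx n c p0 n0).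
rewrite mxeZ mxe_Lmx // add0n eqxx add0r normrM normrN.
rewrite [X in _ = _ * X]ger0_norm ?divr_ge0 // => E.
have n0' : 0 < n%:R / 2 :> R by rewrite divr_gt0 ?ltr0n.
rewrite -(ler_pM2r n0') -E mxe_sum {E}.
apply: le_trans (ler_norm_sum _ _ _) _.
(* [n] bounds the scalar [i] and [n + 1] counts the intermediate indices; dividing by [n / 2], with
   the 2 of [Lmx_weight_half], gives the constant 4. *)
apply: (@le_trans _ _ (\sum_(i < n.+1) n%:R * (n.+1%:R *
    (Q1 (exp_U p i : Uvect R) * Q1 (exp_U p (n - i)) * w)))).
  apply: ler_sum => -[i /= ilt] _.
  rewrite mxeZ normrM ger0_norm // ler_pM ?ler_nat -1?ltnS // mxe_mul.
  apply: le_trans (ler_norm_sum _ _ _) _.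
  rewrite mulr_natl -[n.+1 in leRHS]card_ord -sumr_const.
  apply: ler_sum => -[k /= kn] _; rewrite normrM.
  apply: le_trans (ler_pM (normr_ge0 _) (normr_ge0 _)
    (mxe_exp_le c i p0 (leqnn n) _) (mxe_exp_opp_le c (n - i) p0 _ _)) _ => //.
  rewrite mulrACA -/w; set wk := Lmx_weight c k.
  have wk0 : wk != 0 by rewrite gt_eqF ?Lmx_weight_gt0.
  by rewrite [Lmx_weight c 0]big_ord0 divr1 divfK.
rewrite -!mulr_sumr -mulr_suml -/S.
apply: (@le_trans _ _ (n%:R * (n.+1%:R * (S * (2 * (n`!%:R / 2 ^+ n)))))).
  by do 3!rewrite ler_wpM2l //.
by rewrite le_eqVlt; apply/orP; left; apply/eqP; field; rewrite expf_neq0 // pnatr_eq0.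
Qed.

End LogderivBound.

(** * The two inclusions *)

Section MainInclusions.
Variable R : realType.

(** [exp_monomial_rec] at [k = 1], since substitution in [F = x] returns [gamma]. *)
Lemma is_exp_of_rec (gamma p : nat -> R) n : Diffbar gamma -> p 0%N = 0 ->
  is_exp_of gamma p ->
  n%:R * gamma n.+1 =
  \sum_(j < n) exp_logderiv p (n - j) * (j.+1%:R * gamma j.+1).
Proof.
move=> [g0 _] p0 gp.
have gE m : gamma m = exp_monomial p 1 m.
  rewrite /exp_monomial gp /series_comp.
  have -> : gamma m = series_pow gamma 1 m.
    rewrite -[RHS]/(\sum_(i < m.+1) gamma i * ((m - i)%N == 0%N)%:R).
    rewrite big_ord_recr /= subnn mulr1 big1 ?add0r // => -[i /= im] _.
    by rewrite (_ : (m - i)%N == 0%N = false) ?mulr0 //; lia.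
  case: m => [|m].
    by rewrite big_ord1 mul0r -[LHS]/(\sum_(i < 1) _) big_ord1 g0 mul0r.
  rewrite 2!big_ord_recl mul0r add0r mul1r big1 ?addr0 // => i _.
  by rewrite /bump /= mul0r.
rewrite gE -add1n exp_monomial_rec //; apply: eq_bigr => j _.
by rewrite -gE add1n.
Qed.

(** From [exp p] to [q] by [exp_logderiv_le], then from [q] to [gamma] by Gronwall. The inverse
    binomials absorb all polynomial factors, so the radius stays [2 t]. *)
Lemma Diff_brack_subset (t : R) : 0 < t -> Diff_brack t `<=` Diff (2 * t).
Proof.
move=> t0 gamma [gD [p [p0 gp [_ Ut]]]]; split=> //.
pose U n := t ^+ n * Q1 (exp_U p n : Uvect R).
have U0 n : 0 <= U n by rewrite mulr_ge0 ?Q1_ge0 ?exprn_ge0 ?(ltW t0).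
have {Ut} UB : bounded_sums U.
  by move/(bounded_sums_ereal _ U0): Ut.
(* One factor measures [exp p], the other its inverse. *)
pose V n := \sum_(i < n.+1) U i * U (n - i)%N.
have V0 n : 0 <= V n by apply: sumr_ge0 => i _; rewrite mulr_ge0.
have VB : bounded_sums V by exact: bounded_sums_conv.
pose q n := exp_logderiv p n.
have qV n : (0 < n)%N ->
    `|q n| * (2 * t) ^+ n <= 4 * n.+1%:R * n`!%:R * V n.
  move=> n0; have := exp_logderiv_le p0 n0; rewrite -/(q n) => qn.
  have -> : V n = t ^+ n * \sum_(i < n.+1)
      Q1 (exp_U p i : Uvect R) * Q1 (exp_U p (n - i)).
    rewrite mulr_sumr; apply: eq_bigr => -[i /= im] _.
    by rewrite /U mulrACA -exprD subnKC.
  have tn0 : 0 < (2 * t) ^+ n by rewrite exprn_gt0 ?mulr_gt0.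
  apply: le_trans (ler_wpM2r (ltW tn0) qn) _.
  rewrite exprMn le_eqVlt; apply/orP; left; apply/eqP; field.
  by rewrite expf_neq0 // pnatr_eq0.
pose x n := `|gamma n.+1| * (2 * t) ^+ n / n.+1`!%:R.
have s0 n : 0 <= (2 * t) ^+ n by rewrite exprn_ge0 // mulr_ge0 // ltW.
have x0 n : 0 <= x n by rewrite divr_ge0 ?mulr_ge0.
pose y j := `|gamma j| * (2 * t) ^+ j.-1 / j`!%:R.
apply/(@bounded_sums_ereal _ 2 y) => [n|]; first by rewrite divr_ge0 ?mulr_ge0.
(* [x] starts at the coefficient of [x^1], the sum in [Diff] at that of [x^2]. *)
suff : bounded_sums x.
  move=> [M xM]; exists M => N; apply: le_trans (xM N.+1).
  by rewrite [leRHS]big_ord_recl lerDr.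
(* 8 is the 4 of [exp_logderiv_le] times the 2 of [fact_mul_le]. *)
pose w n := 8 * V n.
apply: (@bounded_sums_gronwall _ x (fun=> 0) w) => //.
- by move=> n; rewrite mulr_ge0.
- by exists 0 => N; rewrite big1.
- by apply: (bounded_sumsZ (c := 8) (x := V)).
move=> n n0; rewrite add0r -ler_pdivrMl ?invr_gt0 ?ltr0n // invrK.
have -> : n%:R * x n = `|n%:R * gamma n.+1| * (2 * t) ^+ n / n.+1`!%:R.
  by rewrite normrM normr_nat !mulrA.
rewrite (is_exp_of_rec _ gD p0 gp) -mulrA.
apply: le_trans (ler_wpM2r _ (ler_norm_sum _ _ _)) _; first exact: divr_ge0.
rewrite mulr_suml; apply: ler_sum => -[j /= jn] _.
have [d dE d0] : exists2 d, n = (j + d)%N & (0 < d)%N.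
  by exists (n - j)%N; lia.
have -> : (n - j)%N = d by lia.
rewrite dE exprD !normrM normr_nat -/(q d).
have fn0 m : m`!%:R != 0 :> R by rewrite pnatr_eq0 -lt0n fact_gt0.
have -> : `|q d| * (j.+1%:R * `|gamma j.+1|) *
    ((2 * t) ^+ j * (2 * t) ^+ d / (j + d).+1`!%:R) =
  x j * ((`|q d| * (2 * t) ^+ d) * (j.+1%:R * j.+1`!%:R / (j + d).+1`!%:R)).
  by rewrite /x; field; rewrite !fn0.
rewrite ler_wpM2l //.
apply: (@le_trans _ _ (4 * d.+1%:R * d`!%:R * V d *
    (j.+1%:R * j.+1`!%:R / (j + d).+1`!%:R))).
  by rewrite ler_wpM2r ?qV // ?divr_ge0 ?mulr_ge0.
have -> : 4 * d.+1%:R * d`!%:R * V d *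
    (j.+1%:R * j.+1`!%:R / (j + d).+1`!%:R) =
  4 * V d * ((d.+1 * j.+1) * (d`! * j.+1`!))%:R / (j + d).+1`!%:R.
  by rewrite !natrM; ring.
rewrite ler_pdivrMr ?ltr0n ?fact_gt0 //.
have -> : w d = 4 * V d * 2 by rewrite /w; ring.
rewrite -(mulrA (4 * V d)) ler_wpM2l ?mulr_ge0 //.
have := fact_mul_le j.+1 d0.
have -> : (d + j.+1 = (j + d).+1)%N by lia.
by rewrite -(ler_nat R) (natrM _ 2).
Qed.

Lemma Q1_UL_le d : Q1 (UL R d) <= d.+1%:R ^+ 2 * 2 ^+ d / d`!%:R.
Proof.
case: d => [|[|m]].
(* [freeL] takes the predecessor of its index, so [UL R 0] is [L_1]. *)
- by rewrite -[UL R 0]/(UL R 1) expr1n mul1r expr0 divr1 Q1_UL1.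
- by apply: le_trans (Q1_UL1 R) _; rewrite divr1 expr1; lra.
apply: le_trans (Q1_UL R m) _.
rewrite ler_pdivlMr ?ltr0n ?fact_gt0 // !factS !natrM.
have fm0 : m`!%:R != 0 :> R by rewrite pnatr_eq0 -lt0n fact_gt0.
have -> : 2 ^+ m / m`!%:R * (m.+2%:R * (m.+1%:R * m`!%:R)) =
    2 ^+ m * (m.+2%:R * m.+1%:R) :> R by field.
have -> : m.+3%:R ^+ 2 * 2 ^+ m.+2 = 2 ^+ m * (4 * m.+3%:R ^+ 2) :> R.
  by rewrite !exprS; ring.
rewrite ler_wpM2l ?exprn_ge0 // -[m.+3%:R]natr1 -[m.+2%:R]natr1 -[m.+1%:R]natr1.
have : 0 <= m%:R :> R by []. nra.
Qed.

(** Gronwall is applied twice: from [gamma] to [q], then from [q] to [exp p]. *)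
Lemma Diff_subset_brack (t eps : R) : 0 < t -> 0 < eps ->
  Diff (2 * t + eps) `<=` Diff_brack t.
Proof.
move=> t0 e0 gamma [gD gs]; split=> //.
have [p p0 gp] := is_exp_of_exists gD.
exists p; split=> //; split; first exact: Ubar_exp_U.
(* Half of [eps] pays for the polynomial factors between [gamma] and [q], the other half for those
   of [Q1_UL_le]. *)
pose s := 2 * t + eps; pose s' := 2 * t + eps / 2.
have s_gt0 : 0 < s by rewrite /s; lra.
have s'_gt0 : 0 < s' by rewrite /s'; lra.
have fn0 m : m`!%:R != 0 :> R by rewrite pnatr_eq0 -lt0n fact_gt0.
have sn0 m : s ^+ m != 0 by rewrite expf_neq0 // gt_eqF.
have s'n0 m : s' ^+ m != 0 by rewrite expf_neq0 // gt_eqF.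
have sn_ge0 n : 0 <= s ^+ n by rewrite exprn_ge0 // ltW.
have s'n_ge0 n : 0 <= s' ^+ n by rewrite exprn_ge0 // ltW.
pose b n := `|gamma n.+1| * s ^+ n / n.+1`!%:R.
have b_ge0 n : 0 <= b n by rewrite divr_ge0 ?mulr_ge0.
have bB : bounded_sums b.
  pose y j := `|gamma j| * s ^+ j.-1 / j`!%:R.
  have y_ge0 n : 0 <= y n by rewrite divr_ge0 ?mulr_ge0.
  have [M bM] : bounded_sums (fun n => y (2 + n)%N) by apply/bounded_sums_ereal.
  exists (b 0%N + M) => -[|N].
    by rewrite big_ord0 addr_ge0 //; have := bM 0%N; rewrite big_ord0.
  by rewrite big_ord_recl lerD2l; exact: bM.
pose B n := n.+1%:R * `|gamma n.+1| * s' ^+ n / n`!%:R.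
have B_ge0 n : 0 <= B n by rewrite divr_ge0 ?mulr_ge0.
have BB : bounded_sums B.
  have [|C C0 rC] := @quadratic_expr_bounded R (s' / s).
    by rewrite divr_gt0 // ltr_pdivrMr // mul1r /s /s'; lra.
  apply: (bounded_sumsZ (c := C) (x := b) (ltW C0) b_ge0 _ bB) => n.
  apply: (@le_trans _ _ (n.+1%:R ^+ 2 * (s' / s) ^+ n * b n)); last first.
    exact: (ler_wpM2r (b_ge0 n) (rC n)).
  rewrite /B /b exprMn exprVn factS natrM le_eqVlt; apply/orP; left; apply/eqP.
  by field; rewrite fn0 sn0 addrC natr1 pnatr_eq0.
pose q n := exp_logderiv p n.
pose x n := `|q n| * s' ^+ n / n`!%:R.
have x_ge0 n : 0 <= x n by rewrite divr_ge0 ?mulr_ge0.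
have xB : bounded_sums x.
  apply: (@bounded_sums_gronwall _ x B B) => // -[//|n] _.
  have := is_exp_of_rec n.+1 gD p0 gp; have [_ g1] := gD.
  (* The term [j = 0] is [q n.+1] because [gamma 1 = 1]; the recursion is solved for it. *)
  rewrite big_ord_recl g1 !mulr1 subn0 -/(q n.+1) => /eqP.
  rewrite -subr_eq => /eqP qE.
  rewrite big_ord_recl /x -[q n.+1]qE -mulrA.
  apply: le_trans (ler_wpM2r _ (ler_normB _ _)) _; first exact: divr_ge0.
  rewrite mulrDl lerD //.
    rewrite /B normrM normr_nat mulrA ler_wpM2r ?invr_ge0 // ler_wpM2r //.
    by rewrite ler_wpM2r // ler_nat.
  (* The nonnegative term with [x 0] on the right is dropped; reversing the sum on the left aligns
     the others. *)
  rewrite mulrDr ler_wpDl ?mulr_ge0 ?invr_ge0 //.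
  rewrite (reindex_inj rev_ord_inj) /=.
  apply: le_trans (ler_wpM2r _ (ler_norm_sum _ _ _)) _; first exact: divr_ge0.
  rewrite mulr_suml mulr_sumr; apply: ler_sum => -[i /= ilt] _.
  rewrite /bump /= !add1n subSS.
  have [d dE] : exists d, n = (i + d)%N by exists (n - i)%N; lia.
  have d0 : (0 < n - i)%N by lia.
  have -> : (n - (n - i.+1) = i.+1)%N by lia.
  have -> : (n - i.+1).+2 = (n - i).+1 by lia.
  rewrite subSS.
  move: d0; have -> : (n - i)%N = d by lia.
  (* [i.+1 + d] is the current rank, and [fni] supplies its inverse for the Gronwall inequality. *)
  rewrite {}dE {n qE ilt} => d0; have fni := fact_mul_addn_le (ltn0Sn i) d0.
  rewrite !normrM normr_nat -/(q i.+1) /B -addSn exprD.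
  have -> : `|q i.+1| * (d.+1%:R * `|gamma d.+1|) *
      (s' ^+ i.+1 * s' ^+ d / (i.+1 + d)`!%:R) =
    (`|q i.+1| * s' ^+ i.+1 / i.+1`!%:R * (d.+1%:R * `|gamma d.+1| * s' ^+ d / d`!%:R))
      * ((i.+1`! * d`!)%:R / (i.+1 + d)`!%:R).
    by rewrite natrM; field; rewrite !fn0.
  rewrite [leRHS]mulrC ler_wpM2l ?(mulr_ge0 (x_ge0 i.+1) (B_ge0 d)) //.
  rewrite ler_pdivrMr ?ltr0n ?fact_gt0 // ler_pdivlMl ?ltr0n //.
  by rewrite -natrM ler_nat addSn.
pose w n := t ^+ n * `|q n| * Q1 (UL R n).
have tn_ge0 n : 0 <= t ^+ n by rewrite exprn_ge0 // ltW.
have w_ge0 n : 0 <= w n by rewrite !mulr_ge0 // Q1_ge0.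
have wB : bounded_sums w.
  have [|C C0 rC] := @quadratic_expr_bounded R (2 * t / s').
    by rewrite divr_gt0 ?mulr_gt0 // ltr_pdivrMr // mul1r /s'; lra.
  apply: (bounded_sumsZ (c := C) (x := x) (ltW C0) x_ge0 _ xB) => n.
  apply: (@le_trans _ _ (n.+1%:R ^+ 2 * (2 * t / s') ^+ n * x n)); last first.
    exact: (ler_wpM2r (x_ge0 n) (rC n)).
  apply: (@le_trans _ _ (t ^+ n * `|q n| * (n.+1%:R ^+ 2 * 2 ^+ n / n`!%:R))).
    by rewrite ler_wpM2l ?mulr_ge0 // Q1_UL_le.
  rewrite /x exprMn exprVn exprMn le_eqVlt; apply/orP; left; apply/eqP.
  by field; rewrite fn0 s'n0.
pose U n := t ^+ n * Q1 (exp_U p n : Uvect R).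
have U_ge0 n : 0 <= U n by rewrite mulr_ge0 ?Q1_ge0.
apply/(@bounded_sums_ereal _ 0 U U_ge0).
apply: (@bounded_sums_gronwall _ U (fun=> 0) w) => //.
  by exists 0 => N; rewrite big1.
move=> n n0; rewrite add0r -ler_pdivrMl ?invr_gt0 ?ltr0n // invrK.
have nR0 : n%:R != 0 :> R by rewrite pnatr_eq0 -lt0n.
have UE : Q1 (exp_U p n : Uvect R) <= n%:R^-1 *
    \sum_(j < n) `|q (n - j)%N| * (Q1 (UL R (n - j)) * Q1 (exp_U p j)).
  have -> : exp_U p n = n%:R^-1 *: (n%:R *: exp_U p n) :> Uvect R.
    by rewrite scalerA mulVf // scale1r.
  (* [exp_U p] is [fexp] on the family [UL], so the recursion holds in [U(vect)]. *)
  rewrite (fexp_rec (@UL_comm R) n p0) (le_trans (Q1Z_le _ _)) //.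
  rewrite ger0_norm ?invr_ge0 // ler_wpM2l ?invr_ge0 //.
  pose F j : Uvect R :=
    exp_logderiv p (n - j) *: (UL R (n - j) * fexp (@UL R) p j).
  apply: le_trans (Q1_sum_le n F) _; apply: ler_sum => j _.
  by rewrite (le_trans (Q1Z_le _ _)) // ler_wpM2l // Q1M_le.
apply: (@le_trans _ _ (t ^+ n * \sum_(j < n)
    `|q (n - j)%N| * (Q1 (UL R (n - j)) * Q1 (exp_U p j)))).
  by rewrite /U mulrCA ler_wpM2l // -ler_pdivlMl ?ltr0n.
rewrite mulr_sumr; apply: ler_sum => -[j /= jn] _.
rewrite -(subnKC (ltnW jn)) {1}exprD addKn /U /w le_eqVlt; apply/orP; left.
by apply/eqP; ring.
Qed.

End MainInclusions.

Theorem mainTheorem5 (R : realType) :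
  (forall t eps : R, 0 < t -> 0 < eps ->
     Diff_brack t `<=` Diff (2 * t) /\ Diff (2 * t + eps) `<=` Diff_brack t) /\
  \bigcap_(t in [set t : R | 0 < t]) Diff_brack t =
  \bigcap_(t in [set t : R | 0 < t]) Diff t.
Proof.
split=> [t eps t0 e0|].
  by split; [exact: Diff_brack_subset|exact: Diff_subset_brack].
apply/seteqP; split=> gamma gI t /= t0.
  (* Radius [t / 2] for this inclusion, [eps = 1] for the converse. *)
  have t20 : 0 < t / 2 by rewrite divr_gt0.
  have := Diff_brack_subset t20 (gI _ t20).
  by rewrite mulrC divfK // pnatr_eq0.
apply: (@Diff_subset_brack R t 1) => //; apply: gI => /=.
by rewrite addr_gt0 // mulr_gt0.
Qed.
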